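(* (Variational Principle for Emergence) Let $f$ be a continuous self-map of a compact metric space $X$, and fix any $\mathsf d\in\{\mathsf W_p:1\le p<\infty\}\cup\{\mathsf{LP}\}$ as the distance on $\mathcal M(X)$. There exists an $f$-invariant Borel probability measure $\mu$ on $X$ such that both $$\limsup_{\epsilon\to0}\frac{\log\log\mathscr E_\mu(f)(\epsilon)}{-\log\epsilon}=\limsup_{\epsilon\to0}\frac{\log\log\mathscr E_{\mathrm{top}}(f)(\epsilon)}{-\log\epsilon}$$ and $$\liminf_{\epsilon\to0}\frac{\log\log\mathscr E_\mu(f)(\epsilon)}{-\log\epsilon}=\liminf_{\epsilon\to0}\frac{\log\log\mathscr E_{\mathrm{top}}(f)(\epsilon)}{-\log\epsilon}.$$
   Context: For a compact (nonempty) metric space $(X,\mathsf d)$, $\mathcal M(X)$ is the set of Borel probability measures on $X$. For $p\ge1$, $\mathsf W_p(\mu,\nu)=\inf_\pi\left(\int_{X\times X}\mathsf d(x,y)^p\,d\pi(x,y)\right)^{1/p}$, the infimum over all probability measures $\pi$ on $X\times X$ with marginals $\mu,\nu$. $\mathsf{LP}(\mu,\nu)$ (Lévy–Prokhorov) is the infimum of $\epsilon>0$ such that for every Borel $E\subset X$, $\nu(E)\le\mu(V_\epsilon(E))+\epsilon$ and $\mu(E)\le\nu(V_\epsilon(E))+\epsilon$, where $V_\epsilon(E)$ is the $\epsilon$-neighborhood of $E$. Topological emergence: $\mathscr E_{\mathrm{top}}(f)(\epsilon)$ is the minimal number of closed $\epsilon$-balls of $\mathcal M(X)$ (for the chosen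 distance) whose union covers the set $\mathcal M_f^{\mathrm{erg}}(X)$ of ergodic $f$-invariant Borel probability measures. Metric emergence: for an $f$-invariant $\mu$, let $\mathbf e^f(x)=\lim_{n\to\infty}\frac1n\sum_{i=0}^{n-1}\delta_{f^i(x)}$ (weak limit, which exists for $\mu$-a.e. $x$). $\mathscr E_\mu(f)(\epsilon)$ is the minimal $N$ for which there exist $\mu_1,\dots,\mu_N\in\mathcal M(X)$ with $\int\min_{1\le i\le N}\mathsf d(\mathbf e^f(x),\mu_i)\,d\mu(x)\le\epsilon$, where $\mathsf d$ is the chosen distance on $\mathcal M(X)$. Both emergences use the same distance. Convention: the quotient $\frac{\log\log N}{-\log\epsilon}$ is read as $0$ when $N=1$. *)

(* Defs.v *)
From HB Require Import structures.
From mathcomp Require Import all_boot all_order all_algebra.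
From mathcomp Require Import all_classical all_reals all_analysis.

Set Implicit Arguments.
Unset Strict Implicit.
Unset Printing Implicit Defensive.

Import Order.TTheory GRing.Theory Num.Theory.
Import numFieldNormedType.Exports.

Local Open Scope classical_set_scope.
Local Open Scope ring_scope.

(* Measurable types are pointed in the library, so a metric space carrying a
   Borel sigma-algebra is given with a point: this is nonemptiness. *)
#[short(type="pmetricType")]
HB.structure Definition PointedMetric (K : numDomainType) :=
  {M of Metric K M & Pointed M}.

(* An element of [probability (borel X) R] is a function on all subsets of X,
   with arbitrary values outside the Borel sets; every notion below only depends
   on its values on Borel sets. *)
Notation borel X := (g_sigma_algebraType (@open X)).

Section distances.
Context {R : realType} {X : pmetricType R}.
Implicit Types (mu nu : probability (borel X) R) (p : R) (e : R).
Local Open Scope ereal_scope.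

(* The product sigma-algebra of [borel X * borel X] is the Borel sigma-algebra
   of X * X when X is compact, since X is then second countable. *)
Definition couplings mu nu : set (probability (borel X * borel X)%type R) :=
  [set pi | forall A : set (borel X), measurable A ->
    pi (A `*` setT) = mu A /\ pi (setT `*` A) = nu A].

Definition wasserstein p mu nu : \bar R :=
  ereal_inf [set poweR (\int[pi]_z (mdist (z.1 : X) (z.2 : X) `^ p)%:E) p^-1
            | pi in couplings mu nu].

Definition neighborhood e (E : set X) : set X := \bigcup_(y in E) ball y e.

Definition levy_prokhorov mu nu : \bar R :=
  ereal_inf [set e%:E | e in [set e : R | (0 < e)%R /\
    forall E : set (borel X), measurable E ->
      nu E <= mu (neighborhood e E) + e%:E /\
      mu E <= nu (neighborhood e E) + e%:E]].

End distances.

Section dynamics.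
Context {R : realType} {X : pmetricType R}.
Implicit Types (f : X -> X) (mu nu : probability (borel X) R).
Local Open Scope ereal_scope.

Definition invariant_measure f mu : Prop :=
  forall A : set (borel X), measurable A -> mu (f @^-1` A) = mu A.

Definition ergodic_measure f mu : Prop :=
  invariant_measure f mu /\
  forall A : set (borel X), measurable A -> f @^-1` A = A ->
    mu A = 0 \/ mu A = 1.

Definition weak_cvg (m : {measure set (borel X) -> \bar R}^nat) nu : Prop :=
  forall g : X -> R, continuous g ->
    (\int[m n]_x g x)%R @[n --> \oo] --> (\int[nu]_x g x)%R.

(* The average of the first n+1 (rather than n) Dirac masses along the orbit,
   so that it is well defined for every n. *)
Definition empirical_measure f (x : X) (n : nat) :
    {measure set (borel X) -> \bar R} :=
  mscale ((n.+1%:R : R)^-1)%:nng%R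
    (msum (fun i => \d_(iter i f x : borel X)) n.+1).

(* A fixed Dirac measure on the null set where there is no limit. *)
Definition empirical_limit f (x : X) : probability (borel X) R :=
  get [set nu | weak_cvg (empirical_measure f x) nu].

End dynamics.

Section emergence.
Context {R : realType} {X : pmetricType R}.
Variable dist : probability (borel X) R -> probability (borel X) R -> \bar R.
Implicit Types (f : X -> X) (mu nu : probability (borel X) R) (e : R).
Local Open Scope ereal_scope.

(* The minimum of a set of natural numbers, +oo if the set is empty. *)
Definition least (A : set nat) : \bar R :=
  ereal_inf [set n%:R%:E | n in A].

Definition topological_emergence f e : \bar R :=
  least [set N | exists c : 'I_N -> probability (borel X) R,
    [set nu | ergodic_measure f nu] `<=`
      \bigcup_(i in [set: 'I_N]) [set nu | dist (c i) nu <= e%:E]].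

Definition metric_emergence f mu e : \bar R :=
  least [set N | exists m : 'I_N -> probability (borel X) R,
    \int[mu]_x (\big[Order.min/+oo]_(i < N) dist (empirical_limit f x) (m i))
      <= e%:E].

End emergence.

(* Convention: 0 when the emergence is 1, where log log is -oo. *)
Definition emergence_quotient {R : realType} (E : R -> \bar R) (e : R) :
    \bar R :=
  if E e == 1%E then 0%E else (lne (lne (E e)) / (- ln e)%:E)%E.

(* Main.v *)
From HB Require Import structures.
Require Import Defs.
From mathcomp Require Import all_boot all_order all_algebra.
From mathcomp Require Import all_classical all_reals all_analysis.
From mathcomp Require Import measurable_realfun ring lra.

(** At the scale exp (- k) choose N k ergodic measures that are pairwise more
    than exp (- k) apart, where N k is the least number of closed balls of
    radius exp (- k) covering the ergodic measures: as fewer balls never cover,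
    the choice is greedy ([separated_ergodic]).  Average them uniformly, and let
    mu be the mixture of these averages over all scales k with the weights
    1 / ((k + 1) (k + 2)) ([scale_mixture_exists]).  This mu is invariant, and it
    is a countable combination of ergodic measures.

    For mu-almost every x the empirical measures of x converge to one of these
    ergodic measures ([empirical_limit_ergodic]), so centers of a cover of the
    ergodic measures quantize mu with the same error.  Hence the metric emergence
    of mu is at most the topological one ([metric_emergence_le_topological]).

    Conversely, n centers are close to at most n of the N k measures of scale k,
    by the triangle inequality.  The other ones contribute to the quantization
    error about exp (- k) / k ^ 2, times their proportion.  Therefore an error e
    much smaller than exp (- k) / k ^ 2 requires n >= N k / 2
    ([metric_emergence_ge_half]).  As the weights decay only polynomially in k,
    this reads: for each eta > 0, the metric emergence at e ^ (1 + eta) is at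
    least half the topological emergence at e, for e small ([half_lower]).  After
    two logarithms the factor 1 / 2 disappears, and the exponent 1 + eta only
    multiplies the quotient by 1 + eta; so the upper limits agree, and so do the
    lower limits ([quotient_limits]).  Where the topological emergence is
    infinite, N k is taken doubly exponential in k ^ 2, and all four limits are
    infinite.

    Three ingredients are proved on the way.
    - There is an ergodic measure, so that the topological emergence is at least
      1 ([ergodic_exists]): a strictly concave, lower semicontinuous functional
      attains its minimum on the invariant measures, and a minimizer is extreme.
      Compactness is obtained from limits along an ultrafilter, turned into
      measures by the outer measure of a content ([content_measure_exists]).
    - Birkhoff's theorem for an ergodic measure and indicator functions
      ([birkhoff_indic]), by a covering argument on orbits ([visits_block]).
      Partitions of small diameter transfer it to continuous functions.
    - The Wasserstein distance satisfies the triangle inequality up to a constant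
      ([wasserstein_quasi_triangle]): two couplings with a common marginal are
      glued conditionally on the cells of a partition of small diameter. *)

Set Implicit Arguments.
Unset Strict Implicit.
Unset Printing Implicit Defensive.
Import Order.TTheory GRing.Theory Num.Theory.
Import numFieldNormedType.Exports.
Local Open Scope classical_set_scope.
Local Open Scope ring_scope.

(** * Probability measures and integrals *)

Section probabilities.
Import HBNNSimple.
Context {d : measure_display} {T : measurableType d} {R : realType}.
Local Open Scope ereal_scope.

Lemma probability_of_measure (m : {measure set T -> \bar R}) :
  m setT = 1 -> exists P : probability T R, forall A, P A = m A.
Proof.
move=> m1; exists (mnormalize m (\d_point : probability T R)) => A.
by rewrite /= /mnormalize m1 /= gt_eqF//= invr1 mule1.
Qed.

Lemma eq_integral_measurable (m1 m2 : {measure set T -> \bar R}) (f : T -> \bar R) :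
  (forall A, measurable A -> m1 A = m2 A) ->
  \int[m1]_x f x = \int[m2]_x f x.
Proof. by move=> m12; apply: eq_measure_integral => A mA _; exact: m12. Qed.

(** Everything below that superposes measures (averages of ergodic measures, the
    measure of the theorem, glued couplings) is an instance of this one. *)
Lemma mixture_exists (w : nat -> R) (P : nat -> probability T R) :
  (forall n, (0 <= w n)%R) -> \sum_(n <oo) (w n)%:E = 1 ->
  exists Q : probability T R,
    (forall A, Q A = \sum_(n <oo) (w n)%:E * P n A) /\
    (forall f : T -> \bar R, (forall x, 0 <= f x) -> measurable_fun setT f ->
      \int[Q]_x f x = \sum_(n <oo) (w n)%:E * \int[P n]_x f x).
Proof.
move=> w0 w1.
pose m n := mscale (NngNum (w0 n)) (P n).
have mT : mseries m 0 setT = 1.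
  rewrite -w1; apply: eq_eseriesr => n _.
  transitivity ((w n)%:E * P n setT); first by [].
  by rewrite probability_setT mule1.
have [Q QE] := probability_of_measure mT.
exists Q; split=> [A|f f0 mf]; first by rewrite QE.
rewrite (@eq_integral_measurable _ (mseries m 0)) => [|A mA]; last exact: QE.
rewrite ge0_integral_measure_series//; apply: eq_eseriesr => n _.
by rewrite ge0_integral_mscale.
Qed.

(** The integrand of the metric emergence is not known to be measurable.  The
    integral of a nonnegative function is the supremum of the integrals of the
    simple functions below it, which suffices for this bound and the next. *)
Lemma integral_ub_conull (m : {measure set T -> \bar R}) (f : T -> \bar R)
    (G : set T) (c : R) : (0 <= c)%R ->
  (forall x, 0 <= f x) -> measurable G -> m (~` G) = 0 ->
  (forall x, G x -> f x <= c%:E) -> \int[m]_x f x <= c%:E * m setT.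
Proof.
move=> c0 f0 mG mG0 fc.
rewrite ge0_integralTE//; apply: ge_ereal_sup => _ /= [h hf <-].
rewrite -integralT_nnsfun -integral_cst//.
apply: ae_ge0_le_integral => //; last 1 first.
- exists (~` G); split => //; first exact: measurableC.
  move=> x /= hx Gx; apply: hx => _.
  by rewrite /= (le_trans (hf x))// fc.
- by move=> x _; rewrite lee_fin; exact: fun_ge0.
- exact/measurable_EFinP/measurable_funTS.
Qed.

Lemma integral_lb_set (m : {measure set T -> \bar R}) (f : T -> \bar R)
    (B : set T) (c : R) : (0 <= c)%R ->
  (forall x, 0 <= f x) -> measurable B ->
  (forall x, B x -> c%:E <= f x) -> c%:E * m B <= \int[m]_x f x.
Proof.
move=> c0 f0 mB fc.
rewrite ge0_integralTE//.
pose h := scale_nnsfun (indic_nnsfun R mB) c0.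
apply: le_ereal_sup_tmp; exists (sintegral m h).
  exists h => // x; have -> : h x = (c * \1_B x)%R by [].
  rewrite indicE.
  by case: (boolP (x \in B)) => [/set_mem/fc|_]; rewrite ?mulr1 ?mulr0.
rewrite /h sintegralrM.
by rewrite sintegral_indic.
Qed.

End probabilities.

(** * Compact metric spaces *)

Section metric.
Context {R : realType} {X : pmetricType R}.

Lemma ballP (x y : X) (e : R) : ball x e y <-> mdist x y < e.
Proof. by rewrite ballEmdist. Qed.

Lemma open_mball (x : X) (e : R) : open (ball x e).
Proof.
rewrite openE => y /ballP xy; rewrite /interior; apply/nbhs_ballP.
exists (e - mdist x y); first by rewrite /= subr_gt0.
move=> z /ballP yz; apply/ballP.
by rewrite (le_lt_trans (metric_triangle x y z))// -ltrBrDl.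
Qed.

Lemma open_borel (U : set X) : open U -> measurable (U : set (borel X)).
Proof. exact: sub_gen_smallest. Qed.

Lemma closed_borel (F : set X) : closed F -> measurable (F : set (borel X)).
Proof.
by move=> cF; rewrite -(setCK F); apply: measurableC; apply: open_borel; rewrite openC.
Qed.

Lemma continuous_borel (f : X -> X) :
  continuous f -> measurable_fun setT (f : borel X -> borel X).
Proof.
move=> cf; apply: (@measurability _ _ (borel X) (borel X) setT f (@open X)) => //.
move=> _ [U oU <-]; rewrite setTI; apply: open_borel.
by move/continuousP : cf; apply.
Qed.

Lemma continuous_real_borel (g : X -> R) :
  continuous g -> measurable_fun setT (g : borel X -> R).
Proof.
move=> cg; apply: (measurability (RGenOInfty.G (R:=R)) (RGenOInfty.measurableE R)).
move=> _ [_ [a ->] <-]; rewrite setTI; apply: open_borel.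
by move/continuousP : cg; apply; exact: itv_open_ends_open.
Qed.

Hypothesis cX : compact [set: X].

Lemma finite_net (e : R) : 0 < e ->
  exists n (c : nat -> X), forall x, exists2 j, (j < n)%N & ball (c j) e x.
Proof.
move=> e0; have := cX; rewrite compact_cover => /(_ _ setT (fun x => ball x e)).
case=> [x _|x _|D _ DX]; first exact: open_mball.
  by exists x => //; exact: ballxx.
exists (size (finmap.enum_fset D)), (nth point (finmap.enum_fset D)) => x.
have [y yD yx] := DX x I; exists (index y (finmap.enum_fset D)).
  by rewrite index_mem; exact: yD.
by rewrite nth_index//; exact: yD.
Qed.

Lemma finite_partition (e : R) : 0 < e ->
  exists n (A : nat -> set (borel X)), [/\ forall j, measurable (A j),
    trivIset setT A, forall j, (n <= j)%N -> A j = set0, \bigcup_j A j = setT &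
    forall j x y, A j x -> A j y -> mdist (x : X) y < e].
Proof.
move=> e0; have [n [c cP]] := @finite_net (e / 2) (divr_gt0 e0 (ltr0Sn _ _)).
pose F j := if (j < n)%N then ball (c j) (e / 2) else set0.
exists n, (seqDU F); split.
- move=> j; apply: seqDU_measurable => {}j; rewrite /F; case: ifP => _; last exact: measurable0.
  by apply: open_borel; exact: open_mball.
- exact: trivIset_seqDU.
- move=> j nj; apply/seteqP; split => // x xj.
  by have := @subset_seqDU _ F j x xj; rewrite /F ltnNge nj.
- rewrite -seqDU_bigcup_eq; apply/seteqP; split => // x _.
  by have [j jn cjx] := cP x; exists j => //; rewrite /F jn.
- move=> j x y xj yj.
  have := @subset_seqDU _ F j x xj; have := @subset_seqDU _ F j y yj.
  rewrite /F; case: ifP => // _.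
  move=> /ballP cy /ballP cx; rewrite (le_lt_trans (metric_triangle x (c j) y))//.
  by rewrite (splitr e) ltrD// metric_sym.
Qed.

Lemma countable_ball_base : exists B : nat -> set X, (forall n, open (B n)) /\
  forall U, open U -> forall x, U x -> exists2 n, B n x & B n `<=` U.
Proof.
have Hk (k : nat) : exists nc : nat * (nat -> X),
    forall x, exists2 j, (j < nc.1)%N & ball (nc.2 j) (k.+1%:R^-1) x.
  by have [//|n [c h]] := @finite_net (k.+1%:R^-1); exists (n, c).
have [nc ncP] := choice Hk.
pose B n := if unpickle n is Some (k, j) then ball ((nc k).2 j) (k.+1%:R^-1)
            else set0.
exists B; split=> [n|U oU x Ux].
  by rewrite /B; case: unpickle => [[k j]|]; [exact: open_mball|exact: open0].
have [e /= e0 eU] : exists2 e : R, 0 < e & ball x e `<=` U.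
  by have /nbhs_ballP[e ? ?] := open_nbhs_nbhs (conj oU Ux); exists e.
have e20 : 0 < e / 2 by rewrite divr_gt0.
have [k _ /(_ k (leqnn _)) /= ke] := near_infty_natSinv_lt (PosNum e20).
have [j _ jx] := ncP k x.
exists (pickle (k, j)); rewrite /B pickleK//.
move=> y /ballP cy; apply/eU/ballP; move/ballP in jx.
rewrite (le_lt_trans (metric_triangle x ((nc k).2 j) y))// (splitr e).
by rewrite ltrD// ?(lt_trans cy)// metric_sym (lt_trans jx).
Qed.

(** The finite intersections of balls of a countable base form a countable
    pi-system that generates the Borel sets. *)
Lemma countable_determining : exists U : nat -> set X, (forall n, open (U n)) /\
  forall mu nu : probability (borel X) R, (forall n, mu (U n) = nu (U n)) ->
  forall A : set (borel X), measurable A -> mu A = nu A.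
Proof.
have [B [oB BP]] := countable_ball_base.
pose I (s : seq nat) := \big[setI/setT]_(i <- s) B i.
have oI s : open (I s).
  elim: s => [|i s IH]; rewrite /I ?big_nil ?big_cons; first exact: openT.
  exact: openI.
exists (fun n => if unpickle n is Some s then I s else setT); split=> [n|mu nu eqU].
  by case: unpickle => // ; exact: openT.
pose G := range I : set (set (borel X)).
have mG : G `<=` measurable by move=> _ [s _ <-]; exact: open_borel.
have GI : setI_closed G.
  by move=> _ _ [s _ <-] [t _ <-]; exists (s ++ t) => //; rewrite /I big_cat.
move=> A mA.
apply: (@g_sigma_algebra_measure_unique _ R (borel X) G mG (fun=> setT)) => //.
- by move=> _; exists [::]; rewrite // /I big_nil.
- by apply: bigcup_const; exists 0%N.
- by move=> _ [s _ <-]; have := eqU (pickle s); rewrite pickleK.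
- by move=> _; rewrite (@le_lt_trans _ _ 1%E) ?probability_le1 ?ltry.
apply: mA; split; first exact: smallest_sigma_algebra.
move=> V oV.
have -> : V = \bigcup_(n in [set n | B n `<=` V]) I [:: n].
  apply/seteqP; split=> [x Vx|x [n nV]].
    have [n nx nV] := BP _ oV x Vx; exists n => //.
    by rewrite /I big_cons big_nil setIT.
  by rewrite /I big_cons big_nil setIT => /nV.
rewrite bigcup_mkcond; apply: sigma_algebra_bigcup => n; case: ifP => _.
  by apply: sub_sigma_algebra; exists [:: n].
exact: sigma_algebra0.
Qed.

(** The sigma-algebra on the product is generated by rectangles; {d < r} is a
    countable union of products of balls, with centers in finite nets. *)
Lemma measurable_mdist :
  measurable_fun setT (fun z : borel X * borel X => mdist (z.1 : X) (z.2 : X)).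
Proof.
have Hk (k : nat) : exists nc : nat * (nat -> X),
    forall x, exists2 j, (j < nc.1)%N & ball (nc.2 j) (k.+1%:R^-1) x.
  by have [//|n [c h]] := @finite_net (k.+1%:R^-1); exists (n, c).
have [nc ncP] := choice Hk.
apply: (measurability (RGenInftyO.G (R:=R)) (RGenInftyO.measurableE R)).
move=> _ [_ [r ->] <-]; rewrite setTI.
rewrite (_ : _ @^-1` _ = \bigcup_k \bigcup_j
   (ball ((nc k).2 j) (k.+1%:R^-1) `*` ball ((nc k).2 j) (r - k.+1%:R^-1))).
  apply: bigcup_measurable => k _; apply: bigcup_measurable => j _.
  by apply: measurableX; apply: open_borel; exact: open_mball.
apply/seteqP; split=> [[x y]|[x y]] /=; rewrite in_itv /=.
  move=> xyr.
  have e20 : 0 < (r - mdist x y) / 2 by rewrite divr_gt0 // subr_gt0.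
  have [k _ /(_ k (leqnn _)) /= ke] := near_infty_natSinv_lt (PosNum e20).
  have [j _ jx] := ncP k x; exists k => //; exists j => //; split => //=.
  apply/ballP; move/ballP in jx.
  rewrite (le_lt_trans (metric_triangle _ x y))// ltrBrDr.
  by move: (mdist _ _) (mdist _ _) _^-1 jx ke => a b q jx ke; lra.
case=> k _ [j _] [/= /ballP cx /ballP cy].
rewrite (le_lt_trans (metric_triangle x ((nc k).2 j) y))// metric_sym.
by rewrite -(subrK (k.+1%:R^-1) r) addrC ltrD.
Qed.

End metric.

(** * Measures built from contents *)

(** A content in the sense of Halmos, on the closed (that is, compact) sets. *)
Record closed_content (R : realType) (X : topologicalType) (lam : set X -> R) :
    Prop := ClosedContent {
  cc_le : forall K L, closed K -> closed L -> K `<=` L -> lam K <= lam L ;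
  cc_leU : forall K L, closed K -> closed L -> lam (K `|` L) <= lam K + lam L ;
  cc_addU : forall K L, closed K -> closed L -> K `&` L = set0 ->
    lam (K `|` L) = lam K + lam L ;
  cc_setT : lam setT = 1 }.

Section content_measure.
Context {R : realType} {X : pmetricType R}.
Hypothesis cX : compact [set: X].
Variable lam : set X -> R.
Hypothesis lamP : closed_content lam.
Local Open Scope ereal_scope.

(** The outer measure of a content is computed from its inner values on open sets. *)
Definition inner_content (U : set X) : \bar R :=
  ereal_sup [set (lam K)%:E | K in [set K | closed K /\ K `<=` U]].

Definition outer_content (A : set X) : \bar R :=
  ereal_inf [set inner_content U | U in [set U | open U /\ A `<=` U]].

Let inner_ge (K U : set X) : closed K -> K `<=` U -> (lam K)%:E <= inner_content U.
Proof. by move=> cK KU; apply: ereal_sup_ubound; exists K. Qed.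

Let inner_le (U : set X) (c : \bar R) :
  (forall K, closed K -> K `<=` U -> (lam K)%:E <= c) -> inner_content U <= c.
Proof. by move=> h; apply: ge_ereal_sup => _ [K [cK KU] <-]; exact: h. Qed.

Let inner_mono (U V : set X) : U `<=` V -> inner_content U <= inner_content V.
Proof.
by move=> UV; apply: inner_le => K cK KU; apply: inner_ge => //; exact: subset_trans UV.
Qed.

Let content0 : lam set0 = 0%R.
Proof.
have := cc_addU lamP (@closed0 X) (@closed0 X) (setI0 _).
by rewrite setU0 => /eqP; rewrite -subr_eq subrr => /eqP.
Qed.

Let inner_ge0 U : 0 <= inner_content U.
Proof. by rewrite -[0]/(0%R%:E) -content0; apply: inner_ge => //; exact: closed0. Qed.

Let inner0 : inner_content set0 = 0.
Proof.
apply/eqP; rewrite eq_le inner_ge0 andbT; apply: inner_le => K cK.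
by rewrite subset0 => ->; rewrite content0.
Qed.

Let inner_le1 U : inner_content U <= 1.
Proof.
by apply: inner_le => K cK _; rewrite lee_fin -(cc_setT lamP); apply: (cc_le lamP).
Qed.

Let innerT : inner_content setT = 1.
Proof.
apply/eqP; rewrite eq_le inner_le1 /= -[1]/(1%R%:E) -(cc_setT lamP).
by apply: inner_ge => //; exact: closedT.
Qed.

(** By normality, a closed subset of the union of two open sets is the union of
    a closed subset of each. *)
Let innerU (U V : set X) : open U -> open V ->
  inner_content (U `|` V) <= inner_content U + inner_content V.
Proof.
move=> oU oV; apply: inner_le => K cK KUV.
have /(@normal_openP R) nX := @pseudometric_normal R X.
have [|||U' [V' [oU' oV' KU' KV' UV0]]] := nX (K `\` U) (K `\` V).
- by rewrite setDE; apply: closedI => //; rewrite closedC.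
- by rewrite setDE; apply: closedI => //; rewrite closedC.
- by rewrite -subset0 => x [[Kx nU] [_ nV]]; case: (KUV x Kx).
have cK1 : closed (K `\` U') by rewrite setDE; apply: closedI => //; rewrite closedC.
have cK2 : closed (K `\` V') by rewrite setDE; apply: closedI => //; rewrite closedC.
have -> : K = (K `\` U') `|` (K `\` V').
  apply/seteqP; split=> [x Kx|x [[]|[]]]//.
  have [xU'|] := pselect (U' x); last by left.
  right; split => // xV'.
  by have : (U' `&` V') x by []; rewrite UV0.
have := cc_leU lamP cK1 cK2; rewrite -lee_fin => /le_trans; apply.
rewrite EFinD; apply: leeD; apply: inner_ge => // x [Kx nx].
  by apply: contrapT => nUx; apply: nx; apply: KU'.
by apply: contrapT => nVx; apply: nx; apply: KV'.
Qed.

(** Compactness reduces a countable cover to a finite one. *)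
Let inner_sigma (F : (set X)^nat) : (forall i, open (F i)) ->
  inner_content (\bigcup_i F i) <= \sum_(i <oo) inner_content (F i).
Proof.
move=> oF; apply: inner_le => K cK KF.
have fin n : open (\bigcup_(i < n) F i) /\
   inner_content (\bigcup_(i < n) F i) <= \sum_(i < n) inner_content (F i).
  elim: n => [|n [oU IH]].
    by rewrite bigcup_mkord !big_ord0 inner0; split => //; exact: open0.
  rewrite bigcup_mkord !big_ord_recr /= -bigcup_mkord; split; first exact: openU.
  by apply: (le_trans (innerU _ _)) => //; exact: leeD.
have : compact K by apply: (subclosed_compact cK cX).
rewrite compact_cover => /(_ _ setT F (fun i _ => oF i)).
case=> [x /KF [i _ Fix]|D _ KD]; first by exists i.
pose n := (\max_(i <- finmap.enum_fset D) i).+1.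
have Kn : K `<=` \bigcup_(i < n) F i.
  move=> x /KD [i iD Fix]; exists i => //=.
  by rewrite /n ltnS; apply: (leq_bigmax_seq i (F := fun i => i)) => //; exact: iD.
apply: (le_trans (inner_ge cK Kn)); apply: (le_trans (fin n).2).
rewrite -(big_mkord xpredT (fun i => inner_content (F i))).
by apply: nneseries_lim_ge => i _ _; exact: inner_ge0.
Qed.

Let outer_open U : open U -> outer_content U = inner_content U.
Proof.
move=> oU; apply/eqP; rewrite eq_le; apply/andP; split.
  by apply: ereal_inf_lbound; exists U => //; split.
by apply: le_ereal_inf_tmp => _ [V [oV UV] <-]; exact: inner_mono.
Qed.

Let outer_le A U : open U -> A `<=` U -> outer_content A <= inner_content U.
Proof. by move=> oU AU; apply: ereal_inf_lbound; exists U. Qed.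

Let outer_ge0 A : 0 <= outer_content A.
Proof. by apply: le_ereal_inf_tmp => _ [V [oV UV] <-]; exact: inner_ge0. Qed.

Let outer_fin A : outer_content A \is a fin_num.
Proof.
rewrite ge0_fin_numE// (@le_lt_trans _ _ 1) ?ltry//.
rewrite (le_trans (@outer_le A setT openT (@subsetT _ A)))//.
Qed.

Let outer0 : outer_content set0 = 0.
Proof. by rewrite outer_open//; exact: open0. Qed.

Let outer_mono : {homo outer_content : A B / A `<=` B >-> A <= B}.
Proof.
move=> A B AB; apply: le_ereal_inf_tmp => _ [V [oV UV] <-].
by apply: outer_le => //; exact: subset_trans UV.
Qed.

Let outer_sigma : sigma_subadditive outer_content.
Proof.
move=> A; apply/lee_addgt0Pr => e e0.
have HU i : exists U, [/\ open U, A i `<=` U &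
    inner_content U <= outer_content (A i) + (e / (2 ^ i.+1)%:R)%:E].
  have ei : (0 < e / (2 ^ i.+1)%:R)%R by rewrite divr_gt0// ltr0n expn_gt0.
  have [_ [U [oU AU] <-] lt] := lb_ereal_inf_adherent ei (outer_fin (A i)).
  by exists U; split => //; exact: ltW.
have [U UP] := choice HU.
apply: le_trans (epsilon_trick xpredT (fun n => outer_ge0 (A n)) (ltW e0)).
apply: (@le_trans _ _ (inner_content (\bigcup_i U i))).
  apply: outer_le; first by apply: bigcup_open => i _; have [] := UP i.
  by move=> x [i _ Aix]; exists i => //; have [_ + _] := UP i; exact.
apply: (le_trans (inner_sigma _)) => [i|]; first by have [] := UP i.
by apply: lee_nneseries => [i _ _|i _]; [exact: inner_ge0|have [] := UP i].
Qed.

HB.instance Definition _ := isOuterMeasure.Build R X outer_content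
  outer0 outer_ge0 outer_mono outer_sigma.

(** For U open containing Y, exhaust U `&` O by a closed K, then U `\` K by a
    closed L: K and L are disjoint, so their contents add up to at most that
    of U. *)
Let open_caratheodory (O : set X) : open O -> outer_content.-caratheodory O.
Proof.
move=> oO; apply: le_caratheodory_measurable => Y.
apply: le_ereal_inf_tmp => _ [U [oU YU] <-].
apply: (@le_trans _ _ (inner_content (U `&` O) + outer_content (Y `&` ~` O))).
  apply: leeD => //; apply: outer_le; first exact: openI.
  by move=> x [/YU Ux Ox].
rewrite -leeBrDr//; apply: inner_le => K cK KUO.
rewrite leeBrDr//.
apply: (@le_trans _ _ ((lam K)%:E + inner_content (U `\` K))).
  rewrite leeD2l//; apply: outer_le.
    by rewrite setDE; apply: openI => //; rewrite openC.
  by move=> x [/YU Ux nOx]; split => // /KUO[].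
rewrite addeC -leeBrDr//; apply: inner_le => L cL LUK; rewrite leeBrDr//.
rewrite -EFinD -(cc_addU lamP cL cK).
  by apply: inner_ge; [exact: closedU|move=> x [/LUK[]|/KUO[]]].
by rewrite -subset0 => x [/LUK[]].
Qed.

Let borel_caratheodory (A : set (borel X)) :
  measurable A -> outer_content.-cara.-measurable A.
Proof.
apply: smallest_sub => //; split.
- exact: measurable0.
- by move=> B mB; rewrite setTD; exact: measurableC.
- by move=> F mF; exact: bigcupT_measurable.
Qed.

Let content_borel : set (borel X) -> \bar R := outer_content.

Let content_borel_additive : semi_sigma_additive content_borel.
Proof.
move=> F mF tF mUF.
apply: (@caratheodory_measure_sigma_additive R X outer_content) => //.
  by move=> i; exact: borel_caratheodory.
exact: borel_caratheodory.
Qed.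

HB.instance Definition _ := isMeasure.Build _ (borel X) R content_borel
  outer0 outer_ge0 content_borel_additive.

Lemma content_measure_exists : exists mu : probability (borel X) R,
  (forall U, open U -> mu U = inner_content U) /\
  (forall A, mu A = outer_content A).
Proof.
have [|mu muE] := @probability_of_measure _ (borel X) R content_borel.
  by rewrite /= /content_borel outer_open//; exact: openT.
by exists mu; split=> [U oU|A]; rewrite muE//; exact: outer_open.
Qed.

End content_measure.

(** * Limits of measures along an ultrafilter *)

Section ultralimit.
Context {R : realType}.

(** A cluster point of the image of an ultrafilter is its limit. *)
Lemma ultra_cvg01 (T : Type) (F : set_system T) (u : T -> R) : UltraFilter F ->
  (forall n, 0 <= u n <= 1) -> exists l : R, u n @[n --> F] --> l.
Proof.
move=> UF u01; have PF := @ultra_proper _ _ UF.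
have [|l [_ cl]] := @segment_compact R 0 1 (u n @[n --> F]) _ _.
  by apply: (@filterE _ F) => n /=; rewrite in_itv /=.
exists l => V Vl; have [//|nV] := in_ultra_setVsetC (u @^-1` V) UF.
by have [r []] := cl (~` V) V nV Vl.
Qed.

End ultralimit.

Section limit_measure.
Context {R : realType} {X : pmetricType R}.
Hypothesis cX : compact [set: X].
Variables (F : set_system nat) (P : nat -> probability (borel X) R).
Hypothesis UF : UltraFilter F.

Lemma fine_prob (m : probability (borel X) R) (A : set (borel X)) :
  measurable A -> (fine (m A))%:E = m A.
Proof. by move=> mA; rewrite fineK// fin_num_measure. Qed.

Lemma fine_prob01 (m : probability (borel X) R) (A : set (borel X)) :
  measurable A -> 0 <= fine (m A) <= 1.
Proof.
move=> mA; rewrite fine_ge0//= -lee_fin fine_prob//.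
exact: probability_le1.
Qed.

(** A limit of measures along an ultrafilter need not be countably additive; it
    is a content. *)
Lemma content_limit_exists : exists lam : set X -> R, closed_content lam /\
  forall A : set (borel X), measurable A -> fine (P k A) @[k --> F] --> lam A.
Proof.
have PF := @ultra_proper _ _ UF.
have H (A : set X) : exists l : R, measurable (A : set (borel X)) ->
    fine (P k A) @[k --> F] --> l.
  have [mA|] := pselect (measurable (A : set (borel X))); last by exists 0.
  have [|l ul] := @ultra_cvg01 R nat F (fun k => fine (P k A)) UF.
    by move=> k; exact: fine_prob01.
  by exists l.
have [lam lamP] := choice H; exists lam; split=> //.
have cb K : closed K -> measurable (K : set (borel X)) by exact: closed_borel.
split.
- move=> K L /cb mK /cb mL KL; apply: (ler_cvg_to (lamP _ mK) (lamP _ mL)).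
  by apply: nearW => k; rewrite -lee_fin !fine_prob// le_measure// inE.
- move=> K L /cb mK /cb mL.
  have mKL := measurableU _ _ mK mL.
  apply: (ler_cvg_to (lamP _ mKL) (cvgD (lamP _ mK) (lamP _ mL))).
  apply: nearW => k; rewrite -lee_fin EFinD !fine_prob//; exact: measureU2.
- move=> K L /cb mK /cb mL KL0.
  have mKL := measurableU _ _ mK mL.
  apply: (cvg_unique _ (lamP _ mKL)) => //.
  rewrite (_ : (fun k => _) = (fun k => fine (P k K) + fine (P k L))).
    exact: cvgD (lamP _ mK) (lamP _ mL).
  apply/funext => k; apply: EFin_inj; rewrite EFinD !fine_prob//.
  by rewrite measureU.
- apply: (cvg_unique _ (lamP _ (@measurableT _ (borel X)))) => //.
  rewrite (_ : (fun k => _) = cst 1); first exact: cvg_cst.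
  by apply/funext => k; rewrite probability_setT.
Qed.

Variable f : X -> X.
Hypothesis cf : continuous f.
Hypothesis Finv : forall A : set (borel X), measurable A ->
  (fine (P k (f @^-1` A)) - fine (P k A)) @[k --> F] --> (0 : R).

(** The content lam of a closed K is at most that of f @` K, because K lies in
    the preimage of f @` K and lam is invariant.  So the measure mu of lam
    satisfies mu (f @^-1` U) <= mu U for U open, then for all Borel sets by outer
    regularity, and equality follows by taking complements.  The last clause is
    the lower semicontinuity of the mass of open sets. *)
Lemma limit_invariant_exists : exists mu : probability (borel X) R,
  invariant_measure f mu /\
  forall U, open U -> forall l, fine (P k U) @[k --> F] --> l -> (mu U <= l%:E)%E.
Proof.
have PF := @ultra_proper _ _ UF.
have [lam [lamC lamP]] := content_limit_exists.
have [mu [muU muA]] := content_measure_exists cX lamC.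
have mf := continuous_borel cf.
have mpre A : measurable (A : set (borel X)) -> measurable (f @^-1` A : set (borel X)).
  by move=> mA; rewrite -[_ @^-1` _]setTI; exact: mf.
have lamf A : measurable (A : set (borel X)) -> lam (f @^-1` A) = lam A.
  move=> mA; apply/eqP; rewrite -subr_eq0; apply/eqP.
  apply: (cvg_unique _ (cvgB (lamP _ (mpre _ mA)) (lamP _ mA))) => //.
  exact: Finv.
have muU_le U : open U -> (mu (f @^-1` U) <= mu U)%E.
  move=> oU; rewrite !muU//; last by move/continuousP : cf; exact.
  apply: ge_ereal_sup => _ [K [cK KU] <-].
  have cfK : closed (f @` K).
    apply: compact_closed; first exact: metric_hausdorff.
    apply: continuous_compact; last exact: subclosed_compact cK cX _.
    by apply: continuous_subspaceT.
  have cpK : closed (f @^-1` (f @` K)).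
    by apply: closed_comp => // x _; exact: cf.
  apply: (@le_trans _ _ (lam (f @` K))%:E).
    rewrite -(lamf (f @` K)); last exact: closed_borel.
    by rewrite lee_fin; apply: (cc_le lamC cK cpK) => x Kx; exists x.
  by apply: ereal_sup_ubound; exists (f @` K) => //; split => // _ [x Kx <-]; exact: KU.
have mu_le A : measurable (A : set (borel X)) -> (mu (f @^-1` A) <= mu A)%E.
  move=> mA; rewrite [leRHS]muA; apply: le_ereal_inf_tmp => _ [U [oU AU] <-].
  rewrite -muU//; apply: (le_trans _ (muU_le _ oU)).
  apply: le_measure; rewrite ?inE; [exact: mpre|by apply: mpre; exact: open_borel|].
  by move=> x; exact: AU.
exists mu; split=> [A mA|U oU l lP].
  apply/eqP; rewrite eq_le mu_le//=.
  have := mu_le _ (measurableC mA).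
  rewrite preimage_setC !probability_setC//; last exact: mpre.
  rewrite -(fine_prob mu mA) -(fine_prob mu (mpre A mA)).
  by rewrite -!EFinB !lee_fin; lra.
rewrite muU//; apply: ge_ereal_sup => _ [K [cK KU] <-].
rewrite lee_fin (cvg_unique _ lP (lamP _ (open_borel oU)))//.
apply: (ler_cvg_to (lamP _ (closed_borel cK)) (lamP _ (open_borel oU))).
apply: nearW => k.
have mK := closed_borel cK; have mU := open_borel oU.
by rewrite -lee_fin !fine_prob// le_measure// inE.
Qed.
End limit_measure.

(** * Existence of an ergodic measure *)

Lemma cvg_sum_ord (R : realType) (T : Type) (F : set_system T) (FF : Filter F)
    (u : nat -> T -> R) (l : nat -> R) (N : nat) :
  (forall n, u n x @[x --> F] --> l n) ->
  (\sum_(n < N) u n x) @[x --> F] --> \sum_(n < N) l n.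
Proof.
move=> ul; elim: N => [|N IH].
  by rewrite big_ord0; under eq_fun do rewrite big_ord0; exact: cvg_cst.
rewrite big_ord_recr /=; under eq_fun do rewrite big_ord_recr /=.
by apply: cvgD; [exact: IH|exact: ul].
Qed.

Section visits.
Context {R : realType} {X : pmetricType R}.
Implicit Types (f : X -> X) (A : set (borel X)) (x : X).

Definition visits f A x (n : nat) : R := \sum_(i < n) \1_A (iter i f x).

Lemma empirical_measureE f x n A :
  empirical_measure f x n A = (n.+1%:R^-1 * visits f A x n.+1)%:E.
Proof.
transitivity ((n.+1%:R^-1)%:E * \sum_(i < n.+1) (\1_A (iter i f x) : R)%:E)%E; first by [].
by rewrite sumEFin.
Qed.

Lemma empirical_probability f x n : exists P : probability (borel X) R,
  forall A, P A = empirical_measure f x n A.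
Proof.
apply: probability_of_measure; rewrite empirical_measureE /visits.
under eq_bigr do rewrite indicT.
by rewrite sumr_const card_ord mulVf.
Qed.

(** Visits to A and to its preimage differ by two boundary terms; hence limits of
    empirical measures are invariant. *)
Lemma visits_shift f A x n :
  visits f (f @^-1` A) x n = visits f A x n + \1_A (iter n f x) - \1_A x.
Proof.
rewrite /visits -[X in X - _](big_ord_recr n (fun i => \1_A (iter i f x) : R)) /=.
rewrite big_ord_recl /= addrAC subrr add0r.
by apply: eq_bigr => i _; rewrite !indicE; congr (_ %:R); apply/idP/idP; rewrite !inE /=.
Qed.

End visits.

Section ergodic_existence.
Context {R : realType} {X : pmetricType R}.
Hypothesis cX : compact [set: X].
Variable f : X -> X.
Hypothesis cf : continuous f.

(** Krylov and Bogolyubov: a limit of the empirical measures of one point. *)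
Lemma invariant_exists : exists mu : probability (borel X) R, invariant_measure f mu.
Proof.
have [F [UF FF]] := ultraFilterLemma (eventually_filter).
have [P PE] := choice (empirical_probability f point).
have [|mu [muI _]] := @limit_invariant_exists R X cX F P UF f cf; last by exists mu.
move=> A mA; apply: cvg_trans (_ : _ @ \oo --> _).
  by apply: cvg_app => ? /FF.
have sub (v a b : R) : v + a - b - v = a - b by ring.
under eq_fun do rewrite !PE !empirical_measureE /= -mulrBr visits_shift sub.
apply/cvgr0Pnorm_le => e e0.
near=> k.
rewrite normrM ger0_norm// (@le_trans _ _ (k.+1%:R^-1))//; last first.
  by near: k; move: (near_infty_natSinv_lt (PosNum e0)); apply: filterS => n /ltW.
rewrite ler_piMr//.
by rewrite !indicE; do 2 case: (_ \in _);
  rewrite ?subrr ?normr0 ?subr0 ?sub0r ?normrN ?normr1 ?ler01.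
Unshelve. all: end_near. Qed.

(** Strictly concave, and increasing on the unit interval, so that composition
    with the mass of an open set stays lower semicontinuous. *)
Definition concave_gauge (t : R) : R := t * (2 - t).

(** The weights have total mass 1. *)
Definition gauge_weight (n : nat) : R := 1 / (2 ^ n.+1)%:R.

Definition concave_energy (U : nat -> set X) (m : probability (borel X) R) : \bar R :=
  (\sum_(n <oo) (gauge_weight n * concave_gauge (fine (m (U n))))%:E)%E.

Lemma gauge_weight_gt0 n : 0 < gauge_weight n.
Proof. by rewrite divr_gt0// ltr0n expn_gt0. Qed.

Lemma concave_gauge_ge0 t : 0 <= t <= 1 -> 0 <= concave_gauge t.
Proof. by move=> /andP[t0 t1]; rewrite mulr_ge0//; lra. Qed.

Lemma concave_gauge_le1 t : concave_gauge t <= 1.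
Proof.
rewrite -subr_ge0 (_ : _ - _ = (1 - t) ^+ 2) ?sqr_ge0//.
by rewrite /concave_gauge; ring.
Qed.

Lemma concave_gauge_le s t : 0 <= s <= 1 -> 0 <= t <= 1 -> s <= t ->
  concave_gauge s <= concave_gauge t.
Proof.
move=> /andP[s0 s1] /andP[t0 t1] st.
rewrite -subr_ge0 (_ : _ - _ = (t - s) * ((1 - s) + (1 - t))).
  by apply: mulr_ge0; lra.
by rewrite /concave_gauge; ring.
Qed.

Section energy.
Variable U : nat -> set X.
Hypothesis oU : forall n, open (U n).

Let mU n : measurable (U n : set (borel X)). Proof. exact: open_borel. Qed.

Let term_ge0 (m : probability (borel X) R) n :
  0 <= gauge_weight n * concave_gauge (fine (m (U n))).
Proof.
by rewrite mulr_ge0 ?(ltW (gauge_weight_gt0 _))// concave_gauge_ge0// fine_prob01.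
Qed.

Lemma concave_energy_ge0 m : (0 <= concave_energy U m)%E.
Proof. by apply: nneseries_ge0 => n _ _; rewrite lee_fin. Qed.

Lemma concave_energy_le1 m : (concave_energy U m <= 1)%E.
Proof.
have := @epsilon_trick R (fun=> 0%E) 1 xpredT (fun=> lexx _) ler01.
rewrite [X in (_ <= X + _)%E]eseries0// add0e => h; apply: le_trans h.
apply: lee_nneseries => [n _ _|n _]; first by rewrite lee_fin.
rewrite add0e lee_fin ler_piMr ?(ltW (gauge_weight_gt0 _))//.
exact: concave_gauge_le1.
Qed.

Lemma concave_energy_fin m : concave_energy U m \is a fin_num.
Proof.
by rewrite ge0_fin_numE ?concave_energy_ge0// (le_lt_trans (concave_energy_le1 _)) ?ltry.
Qed.

(** The direct method: take a limit of a minimizing sequence along an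
    ultrafilter.  The mass of each U n can only drop in the limit, and the gauge
    is increasing, so that each partial sum of the energy can only drop. *)
Lemma concave_energy_min : exists mu : probability (borel X) R,
  invariant_measure f mu /\
  forall nu, invariant_measure f nu -> (concave_energy U mu <= concave_energy U nu)%E.
Proof.
have [mu0 mu0I] := invariant_exists.
pose S := [set concave_energy U nu | nu in [set nu | invariant_measure f nu]].
have i0 : (0 <= ereal_inf S)%E.
  by apply: le_ereal_inf_tmp => _ [nu _ <-]; exact: concave_energy_ge0.
have ifin : ereal_inf S \is a fin_num.
  rewrite ge0_fin_numE// (@le_lt_trans _ _ 1%E) ?ltry//.
  apply: (le_trans _ (concave_energy_le1 mu0)).
  by apply: ereal_inf_lbound; exists mu0.
have Hk (k : nat) : exists nu, invariant_measure f nu /\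
    (concave_energy U nu <= ereal_inf S + (k.+1%:R^-1)%:E)%E.
  have k0 : 0 < k.+1%:R^-1 :> R by [].
  have [_ [nu nuI <-] lt] := lb_ereal_inf_adherent k0 ifin.
  by exists nu; split => //; exact: ltW.
have [P PP] := choice Hk.
have [F [UF FF]] := ultraFilterLemma (eventually_filter).
have PF := @ultra_proper _ _ UF.
have [|mu [muI muU]] := @limit_invariant_exists R X cX F P UF f cf.
  move=> A mA; rewrite (_ : (fun k => _) = cst 0); first exact: cvg_cst.
  by apply/funext => k; rewrite (PP k).1// subrr.
exists mu; split => // nu nuI.
apply: (@le_trans _ _ (ereal_inf S)); last by apply: ereal_inf_lbound; exists nu.
have Hl n : exists l : R, fine (P k (U n)) @[k --> F] --> l.
  by apply: ultra_cvg01 => k; exact: fine_prob01.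
have [l lP] := choice Hl.
have l01 n : 0 <= l n <= 1.
  apply/andP; split.
    apply: (ler_cvg_to (cvg_cst 0) (lP n)); apply: nearW => k.
    by have /andP[] := fine_prob01 (P k) (mU n).
  apply: (ler_cvg_to (lP n) (cvg_cst (1 : R))); apply: nearW => k.
  by have /andP[] := fine_prob01 (P k) (mU n).
apply: lime_le.
  by apply: is_cvg_nneseries => n _ _; rewrite lee_fin.
apply: nearW => N; rewrite big_mkord sumEFin -(fineK ifin) lee_fin.
apply: (@le_trans _ _ (\sum_(n < N) gauge_weight n * concave_gauge (l n))).
  apply: ler_sum => n _; rewrite ler_wpM2l ?(ltW (gauge_weight_gt0 _))//.
  apply: concave_gauge_le => //; first exact: fine_prob01.
  by rewrite -lee_fin fine_prob//; apply: muU (lP n).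
have cl : (\sum_(n < N) gauge_weight n * concave_gauge (fine (P k (U n)))) @[k --> F]
   --> (\sum_(n < N) gauge_weight n * concave_gauge (l n)).
  apply: (@cvg_sum_ord _ _ _ _
    (fun n k => gauge_weight n * concave_gauge (fine (P k (U n))))
    (fun n => gauge_weight n * concave_gauge (l n))) => n.
  apply: cvgM; first exact: cvg_cst.
  apply: cvgM; first exact: lP.
  by apply: cvgB; [exact: cvg_cst|exact: lP].
have cr : (fine (ereal_inf S) + k.+1%:R^-1) @[k --> F] --> fine (ereal_inf S) + 0.
  apply: cvgD; first exact: cvg_cst.
  apply: cvg_trans (_ : _ @ \oo --> _); first by apply: cvg_app => ? /FF.
  exact: cvg_harmonic.
rewrite -[leRHS]addr0; apply: (ler_cvg_to cl cr); apply: nearW => k.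
rewrite -lee_fin EFinD fineK//; apply: le_trans (PP k).2.
rewrite -sumEFin -(big_mkord xpredT
  (fun n => (gauge_weight n * concave_gauge (fine (P k (U n))))%:E)).
by apply: nneseries_lim_ge => n _ _; rewrite lee_fin.
Qed.

End energy.
End ergodic_existence.

Section extremal.
Context {R : realType} {X : pmetricType R}.
Hypothesis cX : compact [set: X].
Variable f : X -> X.
Hypothesis cf : continuous f.

Lemma conditional_invariant (mu : probability (borel X) R) (A : set (borel X)) :
  invariant_measure f mu -> measurable A -> f @^-1` A = A -> 0 < fine (mu A) ->
  exists nu : probability (borel X) R, invariant_measure f nu /\
    forall B : set (borel X), measurable B ->
      fine (mu (B `&` A)) = fine (mu A) * fine (nu B).
Proof.
move=> muI mA fA t0.
have ti0 : 0 <= (fine (mu A))^-1 by rewrite invr_ge0 ltW.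
pose m := mscale (NngNum ti0) (mrestr mu mA).
have mE B : m B = ((fine (mu A))^-1%:E * mu (B `&` A))%E by [].
have [|nu nuE] := @probability_of_measure _ _ _ m.
  rewrite [LHS]mE setTI; rewrite -[X in (_ * X)%E](fine_prob mu mA) -EFinM mulVf ?gt_eqF//.
exists nu; split=> [B mB|B mB].
  rewrite !nuE [LHS]mE [RHS]mE; congr (_ * _)%E.
  by rewrite -[X in _ `&` X]fA -preimage_setI muI//; exact: measurableI.
have mBA : measurable (B `&` A) by exact: measurableI.
by rewrite (etrans (nuE B) (mE B)) -(fine_prob mu mBA) -EFinM /= mulrA divff ?gt_eqF// mul1r.
Qed.

(** Let mu minimize the energy of a determining sequence of open sets.  If an
    invariant A had mass strictly between 0 and 1, mu would be the barycenter of
    its conditionings nu1 and nu2 on A and on its complement, which are invariant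
    and so have at least the energy of mu.  Strict concavity forces nu1 and nu2
    to agree on the determining sequence, hence everywhere; but they differ
    on A. *)
Lemma ergodic_exists : exists mu : probability (borel X) R, ergodic_measure f mu.
Proof.
have [U [oU Udet]] := countable_determining cX.
have mU n : measurable (U n : set (borel X)) by exact: open_borel.
have [mu [muI mumin]] := concave_energy_min cX cf oU.
exists mu; split => // A mA fA.
have [muA0|muA0] := eqVneq (mu A) 0%E; first by left.
have [muA1|muA1] := eqVneq (mu A) 1%E; first by right.
exfalso.
have t0 : 0 < fine (mu A).
  by rewrite -lte_fin fine_prob// lt0e muA0 measure_ge0.
have t1 : 0 < fine (mu (~` A)).
  rewrite probability_setC// -(fine_prob mu mA) -EFinB /= subr_gt0.
  by rewrite -lte_fin fine_prob// lt_neqAle muA1 probability_le1.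
have st : fine (mu (~` A)) = 1 - fine (mu A).
  by rewrite probability_setC// -(fine_prob mu mA) -EFinB.
have [nu1 [nu1I nu1E]] := conditional_invariant muI mA fA t0.
have fCA : f @^-1` (~` A) = ~` A by rewrite -[in RHS]fA.
have [nu2 [nu2I nu2E]] := conditional_invariant muI (measurableC mA) fCA t1.
set t := fine (mu A) in t0 t1 st nu1E nu2E *.
rewrite st in t1 nu2E.
pose x n := fine (nu1 (U n)); pose y n := fine (nu2 (U n)).
have zE n : fine (mu (U n)) = t * x n + (1 - t) * y n.
  rewrite -nu1E// -nu2E//; apply: EFin_inj; rewrite EFinD !fine_prob//.
  - rewrite -measureU//; first by rewrite -setIUr setUv setIT.
    + exact: measurableI. + by apply: measurableI => //; exact: measurableC.
    + by rewrite -setIIr setICr setI0.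
  - by apply: measurableI => //; exact: measurableC.
  - exact: measurableI.
have key (a b : R) : concave_gauge (t * a + (1 - t) * b) =
    t * concave_gauge a + (1 - t) * concave_gauge b + t * (1 - t) * (a - b) ^+ 2.
  by rewrite /concave_gauge; ring.
have w0 n := ltW (@gauge_weight_gt0 R n).
have g01 (m : probability (borel X) R) n :
    0 <= (gauge_weight n : R) * concave_gauge (fine (m (U n))).
  by rewrite mulr_ge0// concave_gauge_ge0// fine_prob01.
pose D := (\sum_(n <oo) ((gauge_weight n : R) * (x n - y n) ^+ 2)%:E)%E.
have dg n : 0 <= (gauge_weight n : R) * (x n - y n) ^+ 2 by rewrite mulr_ge0// sqr_ge0.
have t0' := ltW t0; have t1' := ltW t1.
have muE : (concave_energy U mu = t%:E * concave_energy U nu1 +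
    (1 - t)%:E * concave_energy U nu2 + (t * (1 - t))%:E * D)%E.
  rewrite /concave_energy /D -!nneseriesZl; last 3 first.
  - by move=> n _; rewrite lee_fin.
  - by move=> n _; rewrite lee_fin.
  - by move=> n _; rewrite lee_fin.
  rewrite -!nneseriesD; last 4 first.
  - by move=> n _ _; rewrite adde_ge0// mule_ge0// lee_fin.
  - by move=> n _ _; rewrite mule_ge0// lee_fin// mulr_ge0.
  - by move=> n _ _; rewrite mule_ge0// lee_fin.
  - by move=> n _ _; rewrite mule_ge0// lee_fin.
  apply: eq_eseriesr => n _; rewrite zE key -!EFinM -!EFinD; congr (_%:E).
  by rewrite /x /y; ring.
have E1 := mumin _ nu1I; have E2 := mumin _ nu2I.
have D0 : (D <= 0)%E.
  move: muE E1 E2.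
  rewrite -(fineK (concave_energy_fin oU mu)) -(fineK (concave_energy_fin oU nu1)).
  rewrite -(fineK (concave_energy_fin oU nu2)) !lee_fin.
  set a := fine _; set b := fine _; set c := fine _.
  have D0 : (0 <= D)%E by apply: nneseries_ge0 => n _ _; rewrite lee_fin.
  have tt0 : 0 < t * (1 - t) by exact: mulr_gt0.
  case: (D) D0 => [d| |]//; last first.
    by rewrite gt0_muley ?lte_fin// => _; rewrite -!EFinM -!EFinD addey.
  rewrite !lee_fin -!EFinM -!EFinD => d0 [aE] ab ac.
  suff : t * (1 - t) * d <= 0 by rewrite pmulr_rle0.
  have : t * a <= t * b by rewrite ler_wpM2l.
  have : (1 - t) * a <= (1 - t) * c by rewrite ler_wpM2l.
  lra.
have xy n : nu1 (U n) = nu2 (U n).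
  rewrite -(fine_prob nu1 (mU n)) -(fine_prob nu2 (mU n)); congr (_%:E).
  have : ((gauge_weight n : R) * (x n - y n) ^+ 2)%:E = 0%E :> \bar R.
    apply/eqP; rewrite eq_le; apply/andP; split; last by rewrite lee_fin.
    apply: (le_trans _ D0).
    apply: (@le_trans _ _ (\sum_(0 <= i < n.+1)
        ((gauge_weight i : R) * (x i - y i) ^+ 2)%:E)%E); last first.
      by apply: nneseries_lim_ge => i _ _; rewrite lee_fin.
    rewrite big_nat_recr //= sumEFin -EFinD lee_fin lerDr; apply: sumr_ge0 => i _.
    exact: dg.
  move=> [] /eqP; rewrite mulf_eq0 gt_eqF ?gauge_weight_gt0//= sqrf_eq0 subr_eq0.
  by move/eqP.
have nuA := Udet _ _ xy A mA.
have a1 : t = t * fine (nu1 A) by rewrite -nu1E// setIid.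
have a2 : 0 = (1 - t) * fine (nu2 A) by rewrite -nu2E// setICr measure0.
move: a1; rewrite nuA.
move/esym/eqP: a2; rewrite mulf_eq0 (gt_eqF t1) /= => /eqP ->.
by rewrite mulr0 => t00; rewrite t00 ltxx in t0.
Qed.

End extremal.

(** * The ergodic theorem for indicator functions *)

Section conull.
Context {d : measure_display} {T : measurableType d} {R : realType}.

Definition conull (m : probability T R) (G : set T) :=
  measurable G /\ m (~` G) = 0%E.

Lemma conull_bigcap m (G : nat -> set T) :
  (forall n, conull m (G n)) -> conull m (\bigcap_n G n).
Proof.
move=> cG; have mG : measurable (\bigcap_n G n).
  by apply: bigcap_measurable => // n _; exact: (cG n).1.
split=> //; rewrite setC_bigcap.
apply/negligibleP; first by apply: bigcup_measurable => n _; exact/measurableC/(cG n).1.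
apply: negligible_bigcup => n.
by apply/negligibleP; [exact/measurableC/(cG n).1|exact: (cG n).2].
Qed.

Lemma conullI m (G H : set T) : conull m G -> conull m H -> conull m (G `&` H).
Proof.
move=> [mG G0] [mH H0]; split; first exact: measurableI.
rewrite setCI; apply/negligibleP; first by apply: measurableU; exact: measurableC.
by apply: negligibleU; apply/negligibleP => //; exact: measurableC.
Qed.

Lemma conull1 m (G : set T) : conull m G -> m G = 1%E.
Proof.
move=> [mG]; rewrite probability_setC// => h.
have : (fine (m G))%:E = 1%E :> \bar R.
  move: h; rewrite -[m G]fineK ?fin_num_measure// -EFinB => -[/eqP].
  by rewrite subr_eq0 => /eqP <-.
by rewrite fineK// fin_num_measure.
Qed.

End conull.

Section birkhoff.
Context {R : realType} {X : pmetricType R}.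
Variable f : X -> X.
Hypothesis mf : measurable_fun setT (f : borel X -> borel X).
Implicit Types (A : set (borel X)) (x : X).
Local Notation S := (visits (R := R) f).

Lemma measurable_iter n : measurable_fun setT (iter n f : borel X -> borel X).
Proof.
elim: n => [|n IH]; first exact: measurable_id.
exact: (measurableT_comp mf IH).
Qed.

Lemma measurable_indic_iter A i : measurable A ->
  measurable_fun setT (fun x : borel X => \1_A (iter i f x) : R).
Proof. by move=> mA; exact: measurableT_comp (measurable_indic mA) (measurable_iter i). Qed.

Lemma measurable_visits A n : measurable A ->
  measurable_fun setT (fun x : borel X => S A x n).
Proof.
move=> mA; rewrite /visits; apply: (@measurable_sum _ (borel X)) => i.
exact: measurable_indic_iter.
Qed.

Lemma visits_ge0 A x n : 0 <= S A x n.
Proof. by apply: sumr_ge0 => i _; rewrite indicE. Qed.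

Lemma visits_le A x n : S A x n <= n%:R.
Proof.
rewrite -[X in _ <= X%:R]card_ord -sumr_const; apply: ler_sum => i _.
by rewrite indicE; case: (_ \in _).
Qed.

Lemma visitsD A x m n : S A x (m + n) = S A x m + S A (iter m f x) n.
Proof.
rewrite /visits big_split_ord /=; congr (_ + _); apply: eq_bigr => i _.
by rewrite addnC iterD.
Qed.

Lemma visits1 A x : S A x 1 = \1_A x.
Proof. by rewrite /visits big_ord1. Qed.

Lemma visitsS A x n : S A x n.+1 = \1_A x + S A (f x) n.
Proof. by rewrite -add1n visitsD visits1. Qed.

Lemma visits_subset A B x n : A `<=` B -> S A x n <= S B x n.
Proof.
move=> AB; apply: ler_sum => i _; rewrite !indicE.
case: (boolP (_ \in A)) => [/set_mem /AB/mem_set -> //|_].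
by case: (_ \in B).
Qed.

Lemma visits_setC A x n : S (~` A) x n = n%:R - S A x n.
Proof.
rewrite -[X in X%:R - _]card_ord -sumr_const -sumrB; apply: eq_bigr => i _.
by rewrite !indicE in_setC; case: (_ \in A); rewrite ?subrr ?subr0.
Qed.

Lemma integral_visits (mu : probability (borel X) R) A n :
  invariant_measure f mu -> measurable A ->
  (\int[mu]_x (S A x n)%:E = (n%:R * fine (mu A))%:E)%E.
Proof.
move=> muI mA; rewrite /visits; under eq_integral do rewrite -sumEFin.
have mi i : measurable (iter i f @^-1` A : set (borel X)).
  by rewrite -[_ @^-1` _]setTI; exact: measurable_iter.
have mui i : mu (iter i f @^-1` A) = mu A.
  elim: i => [//|i IH].
  rewrite (_ : iter i.+1 f @^-1` A = f @^-1` (iter i f @^-1` A)) ?muI//.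
  by apply/seteqP; split => x; rewrite /preimage /= -iterSr.
rewrite ge0_integral_sum//; last first.
  by move=> i; apply/measurable_EFinP; exact: measurable_indic_iter.
rewrite (eq_bigr (fun=> mu A)) => [|i _]; last first.
  transitivity (\int[mu]_x (\1_(iter i f @^-1` A : set (borel X)) x)%:E)%E; last first.
    by rewrite integral_indic// setIT; exact: mui.
  apply: eq_integral => x _; rewrite !indicE; congr (_%:R%:E).
by rewrite -(fine_prob mu mA) sumEFin sumr_const card_ord mulr_natl.
Qed.

(** Cut the orbit segment of length N into blocks from the left.  At a point
    where some n <= M has at least c * n visits, take such a block of length n;
    at a point where no n <= M does, which by definition belongs to the enlarged
    set, take a block of length 1.  Every block meets the enlarged set in
    proportion at least c (here c <= 1 is used for the blocks of length 1), and
    the blocks cover all but the last M times. *)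
Lemma visits_block (A : set (borel X)) (c : R) (M N : nat) x : 0 <= c <= 1 ->
  c * (N%:R - M%:R) <=
  S (A `|` [set y | forall n, (0 < n <= M)%N -> S A y n < c * n%:R]) x N.
Proof.
move=> /andP[c0 c1]; set E := [set y | _]; set A' := _ `|` _.
elim/ltn_ind: N x => N IH x.
have [NM|MN] := leqP N M.
  apply: (@le_trans _ _ 0); last exact: visits_ge0.
  by rewrite mulr_ge0_le0// subr_le0 ler_nat.
have [Ex|] := pselect (E x).
  case: N MN IH => // N MN IH; rewrite visitsS.
  have := IH N (ltnSn _) (f x).
  have -> : \1_A' x = 1 :> R by rewrite indicE mem_set//; right.
  by rewrite -natr1; nra.
move=> /existsNP[n /not_implyP[/andP[n0 nM] /negP]]; rewrite -leNgt => cn.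
have nN : (n <= N)%N by exact: leq_trans nM (ltnW MN).
have Nn : (N - n < N)%N by rewrite ltn_subrL n0 (leq_trans n0 nN).
have := IH _ Nn (iter n f x).
have -> : S A' x N = S A' x n + S A' (iter n f x) (N - n).
  by rewrite -visitsD subnKC.
have : S A x n <= S A' x n by apply: visits_subset => y; left.
rewrite natrB// => h1 h2; lra.
Qed.

(** Integrate [visits_block], divide by N and let N grow: c is at most the mass
    of A plus that of the points at which no n <= M is good.  The latter tends to
    0 as M grows, since almost every point has a good n. *)
Lemma maximal_ergodic (mu : probability (borel X) R) A (c : R) (B : set (borel X)) :
  invariant_measure f mu -> measurable A -> 0 <= c <= 1 -> conull mu B ->
  (forall x, B x -> exists2 n, (0 < n)%N & c * n%:R <= S A x n) ->
  c <= fine (mu A).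
Proof.
move=> muI mA c01 [mB B0] hB.
pose E M := [set y : borel X | forall n, (0 < n <= M)%N -> S A y n < c * n%:R].
have mE M : measurable (E M).
  rewrite (_ : E M = \bigcap_(n in [set n | (0 < n <= M)%N])
     (S A ^~ n @^-1` `]-oo, c * n%:R[)); last first.
    apply/seteqP; split => y /= Ey n /Ey /=; rewrite ?in_itv//=.
  apply: bigcap_measurableType => n _; rewrite -[_ @^-1` _]setTI.
  by apply: measurable_visits => //; exact: measurable_itv.
have cvgE : mu (E M) @[M --> \oo] --> 0%E.
  have -> : 0%E = mu (\bigcap_M E M).
    apply/esym; apply: (subset_measure0 (B := ~` B)) => //.
    - by apply: bigcap_measurableType.
    - exact: measurableC.
    - move=> y Ey By; have [n n0 cn] := hB _ By.
      by have := Ey n I n; rewrite n0 leqnn ltNge cn => /(_ isT).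
  apply: nonincreasing_cvg_mu => //.
  - by rewrite (le_lt_trans (probability_le1 _ _)) ?ltry.
  - exact: bigcap_measurableType.
  - move=> m n mn; apply/subsetPset => y Ey k /andP[k0 km].
    by apply: Ey; rewrite k0 (leq_trans km).
have le1 M : c <= fine (mu A) + fine (mu (E M)).
  have mAE := measurableU _ _ mA (mE M).
  have : fine (mu (A `|` E M)) <= fine (mu A) + fine (mu (E M)).
    by rewrite -lee_fin EFinD !fine_prob//; exact: measureU2.
  apply: le_trans.
  have cN N : (M <= N)%N -> c * (N%:R - M%:R) <= N%:R * fine (mu (A `|` E M)).
    move=> MN; rewrite -lee_fin -integral_visits//.
    rewrite -[leLHS]mule1 -[X in (_ * X)%E](@probability_setT _ _ _ mu).
    apply: integral_lb_set => //.
    - by apply: mulr_ge0; [case/andP: c01|rewrite subr_ge0 ler_nat].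
    - by move=> x; rewrite lee_fin visits_ge0.
    - by move=> x _; rewrite lee_fin; exact: visits_block.
  rewrite leNgt; apply/negP; set q := fine _ => qc.
  have cq0 : 0 < c - q by rewrite subr_gt0.
  pose N := (M + Num.truncn ((c * M%:R) / (c - q)) + 1)%N.
  have MN : (M <= N)%N by rewrite /N -addnA leq_addr.
  have := cN N MN; rewrite leNgt => /negP; apply.
  have : (c * M%:R) / (c - q) < N%:R.
    apply: (lt_le_trans (truncnS_gt _)); rewrite ler_nat /N.
    by rewrite addn1 ltnS leq_addl.
  rewrite ltr_pdivrMr// => h.
  move: (N%:R : R) (M%:R : R) h => n m h; rewrite -/q mulrBr; lra.
have cvgf : (fine (mu A) + fine (mu (E M))) @[M --> \oo] --> fine (mu A) + 0.
  apply: cvgD; first exact: cvg_cst.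
  exact: (fine_cvg cvgE).
rewrite -[leRHS]addr0; apply: (ler_cvg_to (cvg_cst c) cvgf); exact: nearW.
Qed.

End birkhoff.

Section birkhoff_ergodic.
Context {R : realType} {X : pmetricType R}.
Variable f : X -> X.
Hypothesis mf : measurable_fun setT (f : borel X -> borel X).
Implicit Types (A : set (borel X)) (x : X).
Local Notation S := (visits (R := R) f).

Definition often_above A (c : R) : set (borel X) :=
  [set x | forall m, exists2 n, (m <= n)%N & c * n%:R <= S A x n].

Lemma measurable_often_above A c : measurable A -> measurable (often_above A c).
Proof.
move=> mA; rewrite (_ : often_above A c =
    \bigcap_m \bigcup_(n in [set n | (m <= n)%N]) (S A ^~ n @^-1` `[c * n%:R, +oo[)).
  apply: bigcap_measurableType => m _; apply: bigcup_measurable => n _.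
  rewrite -[_ @^-1` _]setTI; apply: (measurable_visits mf) => //.
apply/seteqP; split=> x /= H m.
  by move=> _; have [n mn cn] := H m; exists n => //=; rewrite in_itv/= cn.
by have [n mn] := H m I; rewrite /= in_itv/= andbT => cn; exists n.
Qed.

Lemma often_above_comp A c c' x : c' < c ->
  often_above A c x -> often_above A c' (f x).
Proof.
move=> cc H m.
(* After N steps, the gain (c - c') * n pays for one visit and one unit of time. *)
pose N := (Num.truncn ((1 + `|c'|) / (c - c'))).+1.
have [n] := H (m + N).+1.
case: n => // n; rewrite ltnS => mNn; rewrite visitsS => cn.
exists n; first exact: leq_trans (leq_addr _ _) mNn.
have a1 : \1_A x <= 1 :> R by rewrite indicE; case: (_ \in _).
have : (1 + `|c'|) / (c - c') < n%:R.
  by rewrite (lt_le_trans (truncnS_gt _))// ler_nat (leq_trans (leq_addl m N)).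
rewrite ltr_pdivrMr ?subr_gt0// => h.
have := ler_norm (- c'); rewrite normrN => c'n.
move: cn; rewrite -natr1; move: (n%:R : R) h (\1_A x : R) a1 => u h v a1 cn; lra.
Qed.

Lemma often_above_compV A c c' x : c' < c ->
  often_above A c (f x) -> often_above A c' x.
Proof.
move=> cc H m.
pose N := (Num.truncn (`|c'| / (c - c'))).+1.
have [n mNn cn] := H (m + N)%N.
exists n.+1; first by rewrite (leq_trans (leq_trans (leq_addr _ _) mNn)).
rewrite visitsS.
have a1 : 0 <= \1_A x :> R by rewrite indicE.
have : `|c'| / (c - c') < n%:R.
  by rewrite (lt_le_trans (truncnS_gt _))// ler_nat (leq_trans (leq_addl m N)).
rewrite ltr_pdivrMr ?subr_gt0// => h.
have c'n := ler_norm c'.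
move: cn; rewrite -natr1; move: (n%:R : R) h (\1_A x : R) a1 => u h v a1 cn; lra.
Qed.

(** The slack 1 / (j + 1), for some j, makes this set invariant on the nose:
    a shift of time costs an arbitrarily small amount of the level
    ([often_above_comp] and [often_above_compV]). *)
Definition exceeds A (a : R) : set (borel X) :=
  \bigcup_j often_above A (a + j.+1%:R^-1).

Lemma exceeds_invariant A a : f @^-1` (exceeds A a) = exceeds A a.
Proof.
have lt j : a + j.+2%:R^-1 < a + j.+1%:R^-1 :> R.
  by rewrite ltrD2l ltf_pV2 ?posrE// ltr_nat.
apply/seteqP; split=> x /= [j _ jx]; exists j.+1 => //.
  exact: often_above_compV (lt j) jx.
exact: often_above_comp (lt j) jx.
Qed.

Variable mu : probability (borel X) R.
Hypothesis muE : ergodic_measure f mu.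

(** The set of points that exceed a is invariant, so it has mass 0 or 1; mass 1
    with a larger than the mass of A contradicts [maximal_ergodic]. *)
Lemma conull_not_exceeds A : measurable A ->
  conull mu (~` exceeds A (fine (mu A))).
Proof.
move=> mA; have mE : measurable (exceeds A (fine (mu A))).
  by apply: bigcup_measurable => j _; exact: measurable_often_above.
pose B j : set (borel X) := exceeds A (fine (mu A) + j.+1%:R^-1).
have mB j : measurable (B j).
  by apply: bigcup_measurable => i _; exact: measurable_often_above.
have B0 j : mu (B j) = 0%E.
  have [//|B1] := muE.2 _ (mB j) (exceeds_invariant _ _).
  have cB : conull mu (B j).
    by split => //; rewrite probability_setC// [X in (_ - X)%E]B1 subee.
  exfalso.
  have cn x : B j x -> exists2 n, (0 < n)%N &
      (fine (mu A) + j.+1%:R^-1) * n%:R <= S A x n.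
    move=> [i _ /(_ 1%N)[n n0 h]]; exists n => //; apply: le_trans h.
    by rewrite ler_wpM2r// lerDl.
  have : fine (mu A) + j.+1%:R^-1 <= fine (mu A).
    apply: (maximal_ergodic mf muE.1 mA _ cB cn).
    have /andP[A0 _] := fine_prob01 mu mA.
    apply/andP; split; first by rewrite addr_ge0.
    have [x Bx] : exists x, B j x.
      apply/set0P/eqP => B00; move: B1; rewrite [X in mu X]B00 measure0 => /eqP.
      by rewrite eq_sym onee_eq0.
    have [n n0 h] := cn x Bx.
    have := le_trans h (visits_le f A x n).
    by rewrite -[leRHS]mul1r ler_pM2r ?ltr0n// addr_ge0// fine_ge0.
  by rewrite gerDl leNgt invr_gt0 ltr0n.
apply: (_ : conull mu (\bigcap_j ~` B j) -> _); last first.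
  apply: conull_bigcap => j; split; first exact: measurableC.
  by rewrite setCK B0.
suff -> : \bigcap_j ~` B j = ~` exceeds A (fine (mu A)) by [].
rewrite -setC_bigcup; congr (~` _); apply/seteqP; split=> x.
  move=> [j _ [i _ h]]; exists i => //= m; have [n mn cn] := h m; exists n => //.
  apply: le_trans cn; rewrite ler_wpM2r//; rewrite lerD2r lerDl//.
(* The slack 1 / (i + 1) is shared equally between the two unions. *)
move=> [i _ h]; exists i.*2.+1 => //; exists i.*2.+1 => // m.
have [n mn cn] := h m; exists n => //; apply: le_trans cn.
rewrite ler_wpM2r// -addrA lerD2l.
have -> : (i.*2.+2%:R : R) = 2 * i.+1%:R by rewrite -natrM mul2n doubleS.
by rewrite invfM ![2^-1 * _]mulrC -splitr.
Qed.

Lemma visits_freq_le A : measurable A -> exists G, conull mu G /\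
  forall x, G x -> forall e, 0 < e ->
    \forall n \near \oo, S A x n <= (fine (mu A) + e) * n%:R.
Proof.
move=> mA; exists (~` exceeds A (fine (mu A))); split; first exact: conull_not_exceeds.
move=> x nx e e0.
have [j _ /(_ j (leqnn _)) /= je] := near_infty_natSinv_lt (PosNum e0).
have /existsNP[m hm] : ~ often_above A (fine (mu A) + j.+1%:R^-1) x.
  by move=> h; apply: nx; exists j.
near=> n; rewrite leNgt; apply/negP => lt; apply: hm; exists n.
  by near: n; exists m.
rewrite (le_trans _ (ltW lt))// ler_wpM2r// lerD2l; exact: ltW.
Unshelve. all: end_near. Qed.

(** The upper bound for the complement of A is the lower bound for A. *)
Lemma birkhoff_indic A : measurable A -> exists G, conull mu G /\
  forall x, G x -> n.+1%:R^-1 * S A x n.+1 @[n --> \oo] --> fine (mu A).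
Proof.
move=> mA; have [G [cG GP]] := visits_freq_le mA.
have [H [cH HP]] := visits_freq_le (measurableC mA).
exists (G `&` H); split; first exact: conullI.
move=> x [/GP Gx /HP Hx]; apply/cvgrPdist_le => e e0.
have [N1 _ h1] := Gx e e0; have [N2 _ h2] := Hx e e0.
exists (maxn N1 N2) => // n /= nN.
have N1n : (N1 <= n.+1)%N by rewrite (leq_trans (leq_maxl _ _) (leqW nN)).
have N2n : (N2 <= n.+1)%N by rewrite (leq_trans (leq_maxr _ _) (leqW nN)).
have := h1 _ N1n; have := h2 _ N2n; rewrite /= visits_setC.
have -> : fine (mu (~` A)) = 1 - fine (mu A).
  by rewrite probability_setC// -(fine_prob mu mA) -EFinB.
have n0 : 0 < n.+1%:R :> R by [].
rewrite ler_distlC [_^-1 * _]mulrC ler_pdivrMr// ler_pdivlMr//.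
by move: (n.+1%:R : R) n0 => u u0 k1 k2; apply/andP; split; lra.
Qed.

End birkhoff_ergodic.

(** * Generic points *)

Section bounded_integrals.
Context {d : measure_display} {T : measurableType d} {R : realType}.
Variable m : probability T R.

Lemma bounded_integrable (h : T -> R) (M : R) :
  measurable_fun setT h -> (forall x, `|h x| <= M) -> m.-integrable setT (EFin \o h).
Proof.
move=> mh hM; apply: measurable_bounded_integrable => //.
  by rewrite (le_lt_trans (probability_le1 _ _)) ?ltry.
exists M; split; first exact: num_real.
by move=> N MN x _; exact: le_trans (hM x) (ltW MN).
Qed.

Lemma indic_integrable (v : R) (A : set T) : measurable A ->
  m.-integrable setT (EFin \o (fun x => v * \1_A x)).
Proof.
move=> mA; apply: (@bounded_integrable _ `|v|).
  by apply: measurable_funM; [exact: measurable_cst|exact: measurable_indic].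
by move=> x; rewrite normrM ler_piMr// indicE; case: (_ \in _); rewrite ?normr1 ?normr0.
Qed.

Lemma Rintegral_step (v : nat -> R) (A : nat -> set T) (n : nat) :
  (forall j, measurable (A j)) ->
  m.-integrable setT (EFin \o (fun x => \sum_(j < n) v j * \1_(A j) x)) /\
  \int[m]_x (\sum_(j < n) v j * \1_(A j) x) = \sum_(j < n) v j * fine (m (A j)).
Proof.
move=> mA; elim: n => [|n [IHi IH]].
  split.
    apply: (@bounded_integrable _ 0); last by move=> x; rewrite big_ord0 normr0.
    by rewrite (_ : (fun x => _) = cst 0)//; apply/funext => x; rewrite big_ord0.
  under eq_Rintegral do rewrite big_ord0.
  by rewrite Rintegral_cst// mul0r big_ord0.
have ii := indic_integrable (v n) (mA n).
split.
  rewrite (_ : _ \o _ = ((EFin \o (fun x => \sum_(j < n) v j * \1_(A j) x)%R) \+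
    (EFin \o (fun x => v n * \1_(A n) x)%R))%E); first exact: integrableD.
  by apply/funext => x /=; rewrite big_ord_recr.
under eq_Rintegral do rewrite big_ord_recr /=.
rewrite RintegralD// IH big_ord_recr /=; congr (_ + _).
rewrite RintegralZl//; last first.
  by have := indic_integrable 1 (mA n); rewrite (_ : (fun x => _) = \1_(A n))//;
    apply/funext => x; rewrite mul1r.
by congr (_ * _); rewrite /Rintegral integral_indic// setIT.
Qed.

End bounded_integrals.

Section generic.
Context {R : realType} {X : pmetricType R}.
Hypothesis cX : compact [set: X].
Implicit Types (g : X -> R).

Lemma compact_unif_continuous g (e : R) : continuous g -> 0 < e ->
  exists k : nat, forall x y, mdist x y < k.+1%:R^-1 -> `|g x - g y| < e.
Proof.
move=> cg e0; apply: contrapT => /forallNP H.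
have Hk (k : nat) : exists xy : X * X,
    mdist xy.1 xy.2 < k.+1%:R^-1 /\ e <= `|g xy.1 - g xy.2|.
  have /existsNP[x /existsNP[y /not_implyP[xy /negP]]] := H k.
  by rewrite -leNgt => exy; exists (x, y).
have [u uP] := choice Hk.
have [|p [_ clp]] := cX (F := (fst \o u) @ \oo) _ _; first exact: filterT.
have e20 : 0 < e / 2 by rewrite divr_gt0.
have : nbhs p [set y | `|g p - g y| < e / 2].
  by have /cvgrPdist_lt/(_ _ e20) := cg p.
move=> /nbhs_ballP[r /= r0 rP].
have r20 : 0 < r / 2 by rewrite divr_gt0.
have [K _ KP] := near_infty_natSinv_lt (PosNum r20).
have [] := clp [set y | exists2 k, (K <= k)%N & (u k).1 = y] (ball p (r / 2)).
- by exists K => // k /= Kk; exists k.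
- by apply/nbhs_ballP; exists (r / 2).
move=> _ [[k Kk <-] /ballP pk].
have [uk ek] := uP k; have /= kr := KP k Kk.
have h1 : `|g p - g (u k).1| < e / 2.
  by apply: rP; apply/ballP; apply: (lt_trans pk); lra.
have h2 : `|g p - g (u k).2| < e / 2.
  apply: rP; apply/ballP; apply: (le_lt_trans (metric_triangle p (u k).1 (u k).2)).
  have {}uk := lt_trans uk kr; lra.
move: ek; rewrite leNgt => /negP; apply.
rewrite (_ : g _ - g _ = (g p - g (u k).2) - (g p - g (u k).1)); last by ring.
by rewrite (le_lt_trans (ler_normB _ _))// (splitr e) ltrD.
Qed.

Lemma continuous_bounded g : continuous g -> exists M, forall x, `|g x| <= M.
Proof.
move=> cg.
have /compact_bounded[M [_ Mg]] := continuous_compact (continuous_subspaceT cg) cX.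
by exists (M + 1) => x; apply: (Mg (M + 1)); [rewrite ltrDl|exists x].
Qed.

Lemma continuous_integrable (m : probability (borel X) R) g : continuous g ->
  m.-integrable setT (EFin \o (g : borel X -> R)).
Proof.
move=> cg; have [M gM] := continuous_bounded cg.
exact: bounded_integrable (continuous_real_borel cg) gM.
Qed.

Lemma step_value (T : Type) (n : nat) (A : nat -> set T) (v : nat -> R) (x : T) (i : nat) :
  trivIset setT A -> (i < n)%N -> A i x -> \sum_(j < n) v j * \1_(A j) x = v i.
Proof.
move=> tA i_n Ax; rewrite (bigD1 (Ordinal i_n))//= indicE mem_set// mulr1.
rewrite big1 ?addr0// => j ji; rewrite indicE memNset ?mulr0// => Ajx.
have /(_ I I (ex_intro _ x (conj Ajx Ax))) ij := tA j i.
by move: ji; rewrite -val_eqE /= ij eqxx.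
Qed.

(** The coefficients do not depend on the measure: convergence of the masses of
    the cells is convergence of the integrals, up to the oscillation of g. *)
Lemma Rintegral_partition g (e : R) (n : nat) (A : nat -> set (borel X)) :
  continuous g ->
  (forall j, measurable (A j)) -> trivIset setT A ->
  (forall j, (n <= j)%N -> A j = set0) -> \bigcup_j A j = setT ->
  (forall j x y, A j x -> A j y -> `|g x - g y| <= e) ->
  exists v : nat -> R, forall m : probability (borel X) R,
    `| \int[m]_x g x - \sum_(j < n) v j * fine (m (A j)) | <= e.
Proof.
move=> cg mA tA An AT Ae.
have /choice[c cP] : forall j, exists y : X, forall x, A j x -> A j y.
  move=> j; have [[x Ajx]|nA] := pselect (exists x, A j x).
    by exists x.
  by exists point => x Ax; exfalso; apply: nA; exists x.
exists (fun j => g (c j)) => m.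
have [si <-] := Rintegral_step m (fun j => g (c j)) n mA.
rewrite -RintegralB//; last exact: continuous_integrable.
have ge x : `|g x - \sum_(j < n) g (c j) * \1_(A j) x| <= e.
  have [i _ Aix] : (\bigcup_j A j) x by rewrite AT.
  have i_n : (i < n)%N by rewrite ltnNge; apply/negP => /An Ai0; rewrite Ai0 in Aix.
  rewrite (_ : \sum_(j < n) _ = g (c i)).
    by apply: (Ae i) => //; exact: cP Aix.
  exact: (@step_value (borel X) n A (fun j => g (c j)) x i).
have mB : measurable_fun setT (fun x : borel X => g x - \sum_(j < n) g (c j) * \1_(A j) x).
  apply: measurable_funB; first exact: continuous_real_borel.
  by move: si => /integrableP[/measurable_EFinP].
have iB := bounded_integrable m mB ge.
apply: (le_trans (le_normr_Rintegral measurableT iB)).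
rewrite -[leRHS]mulr1 -[X in _ * X]/(fine 1%E) -(@probability_setT _ _ _ m).
rewrite -Rintegral_cst//; apply: le_Rintegral => //.
  apply: (@bounded_integrable _ _ _ m _ e); first exact: measurableT_comp.
  by move=> x; rewrite normr_id.
by apply: (@bounded_integrable _ _ _ m _ `|e|) => //; exact: measurable_cst.
Qed.

Variable f : X -> X.
Hypothesis cf : continuous f.

(** Birkhoff's theorem is applied to the countably many cells of a sequence of
    finite partitions whose diameters tend to 0. *)
Lemma generic_points (mu : probability (borel X) R) : ergodic_measure f mu ->
  exists G, conull mu G /\ forall x, G x -> weak_cvg (empirical_measure f x) mu.
Proof.
move=> muE; have mf := continuous_borel cf.
have Hk (k : nat) : exists nA : nat * (nat -> set (borel X)),
   [/\ forall j, measurable (nA.2 j),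
    trivIset setT nA.2, forall j, (nA.1 <= j)%N -> nA.2 j = set0,
    \bigcup_j nA.2 j = setT &
    forall j x y, nA.2 j x -> nA.2 j y -> mdist (x : X) y < k.+1%:R^-1].
  have [//|n [A AP]] := @finite_partition R X cX (k.+1%:R^-1).
  by exists (n, A).
have [nA nAP] := choice Hk.
have HG k : exists G : nat -> set (borel X), forall j, conull mu (G j) /\
    forall x, G j x -> n.+1%:R^-1 * visits f ((nA k).2 j) x n.+1 @[n --> \oo] -->
      fine (mu ((nA k).2 j)).
  have /choice[G GP] : forall j, exists G : set (borel X), conull mu G /\
      forall x, G x -> n.+1%:R^-1 * visits f ((nA k).2 j) x n.+1 @[n --> \oo] -->
      fine (mu ((nA k).2 j)).
    by move=> j; apply: birkhoff_indic => //; have [] := nAP k.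
  by exists G.
have [G GP] := choice HG.
exists (\bigcap_k \bigcap_j G k j); split.
  by apply: conull_bigcap => k; apply: conull_bigcap => j; exact: (GP k j).1.
move=> x Gx g cg.
have [P PE] := choice (@empirical_probability R X f x).
rewrite (_ : (fun n => _) = (fun n => \int[P n]_x g x)); last first.
  by apply/funext => n; congr fine; apply: eq_integral_measurable => A _; exact/esym/PE.
apply/cvgrPdist_le => e e0.
have e30 : 0 < e / 3 by rewrite divr_gt0.
have [k kP] := compact_unif_continuous cg e30.
have [mA tA An AT Ak] := nAP k.
have [|v vP] := @Rintegral_partition g (e / 3) _ _ cg mA tA An AT.
  by move=> j y z yA zA; apply/ltW/kP; exact: Ak yA zA.
have cs : (\sum_(j < (nA k).1) v j * fine (P n ((nA k).2 j))) @[n --> \oo] -->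
    \sum_(j < (nA k).1) v j * fine (mu ((nA k).2 j)).
  apply: (@cvg_sum_ord _ _ _ _ (fun j n => v j * fine (P n ((nA k).2 j)))
      (fun j => v j * fine (mu ((nA k).2 j)))) => j.
  apply: cvgM; first exact: cvg_cst.
  under eq_fun do rewrite PE empirical_measureE.
  by apply: (GP k j).2; exact: Gx.
have /cvgrPdist_le/(_ _ e30) := cs; apply: filterS => n.
have := vP mu; have := vP (P n).
move: (\int[_]_x _) (\int[_]_x _) (\sum_(_ < _) _) (\sum_(_ < _) _) => a b c d.
rewrite !ler_norml => /andP[? ?] /andP[? ?] /andP[? ?]; apply/andP; split; lra.
Qed.

End generic.

Section weak_unique.
Context {R : realType} {X : pmetricType R}.
Hypothesis cX : compact [set: X].

(** A probability measure is a function on all subsets, whose values outside the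
    Borel sets are arbitrary. *)
Definition borel_eq (mu nu : probability (borel X) R) :=
  forall A : set (borel X), measurable A -> mu A = nu A.

Lemma open_neighborhood (e : R) (E : set X) : open (neighborhood e E).
Proof. by apply: bigcup_open => y _; exact: open_mball. Qed.

(** Exhaust U by the closed sets K k of points at distance at least 1 / (k + 1)
    from its complement, and compare the masses of K k and U with the integral of
    a Urysohn function between them. *)
Lemma weak_open_le (mu nu : probability (borel X) R) (U : set X) :
  (forall g : X -> R, continuous g -> \int[mu]_x g x = \int[nu]_x g x) ->
  open U -> (mu U <= nu U)%E.
Proof.
move=> H oU.
pose K (k : nat) : set (borel X) := ~` neighborhood (k.+1%:R^-1) (~` U).
have oN k := open_neighborhood (k.+1%:R^-1) (~` U).
have cK k : closed (K k : set X) by rewrite closedC.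
have mK k : measurable (K k) by exact: closed_borel.
have KU k : K k `<=` U.
  by move=> x Kx; apply: contrapT => nU; apply: Kx; exists x => //; exact: ballxx.
have UK : \bigcup_k K k = U.
  apply/seteqP; split=> [x [k _ /KU]//|x Ux].
  have /nbhs_ballP[e /= e0 eU] := open_nbhs_nbhs (conj oU Ux).
  have [k _ /(_ k (leqnn _)) /= ke] := near_infty_natSinv_lt (PosNum e0).
  exists k => // -[y nUy /ballP yx]; apply: nUy; apply/eU/ballP.
  by rewrite metric_sym (lt_trans yx).
have ndK : {homo K : n m / (n <= m)%N >-> (n <= m)%O}.
  move=> n m nm; apply/subsetPset => x Kx [y Uy /ballP yx]; apply: Kx.
  exists y => //; apply/ballP; apply: (lt_le_trans yx).
  by rewrite lef_pV2 ?posrE// ler_nat ltnS.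
have mU := open_borel oU.
have cvgK : mu (K k) @[k --> \oo] --> mu U.
  rewrite -[X in _ --> mu X]UK; apply: nondecreasing_cvg_mu => //.
  exact: bigcup_measurable.
have KnU k : (mu (K k) <= nu U)%E.
  have [||||h [ch h0 h1 h01]] := @urysohn_ext_itv X R (@pseudometric_normal R X) (~` U) (K k) 0 1.
  - by rewrite closedC.
  - exact: cK.
  - by rewrite -subset0 => x [nU /KU].
  - exact: ltr01.
  have hb x : 0 <= h x <= 1.
    by have := h01 (h x) (ex_intro2 _ _ x I erefl); rewrite /= in_itv.
  have ih (m : probability (borel X) R) := continuous_integrable cX m ch.
  have [iK eK] := Rintegral_step mu (fun=> 1) 1 (fun=> mK k).
  have [iU eU] := Rintegral_step nu (fun=> 1) 1 (fun=> mU).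
  rewrite big_ord1 mul1r in eK; rewrite big_ord1 mul1r in eU.
  rewrite -(fine_prob mu (mK k)) -(fine_prob nu mU) lee_fin -eK -eU.
  apply: (@le_trans _ _ (\int[mu]_x h x)).
    apply: le_Rintegral => //; first exact: ih.
    move=> x _; rewrite big_ord1 mul1r indicE.
    have /andP[h0x _] := hb x.
    case: (boolP (x \in K k)) => // /set_mem Kx.
    by have /= <- := h1 (h x) (ex_intro2 _ _ x Kx erefl).
  rewrite H//; apply: le_Rintegral => //; first exact: ih.
  move=> x _; rewrite big_ord1 mul1r indicE.
  have /andP[_ h1x] := hb x.
  case: (boolP (x \in U)) => // /negP xU.
  have nU : (~` U) x by move=> Ux; apply: xU; exact: mem_set.
  by have /= -> := h0 (h x) (ex_intro2 _ _ x nU erefl).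
rewrite -(cvg_lim _ cvgK)//; apply: lime_le; first by apply/cvg_ex; exists (mu U).
exact: nearW.
Qed.

Lemma weak_unique (mu nu : probability (borel X) R) :
  (forall g : X -> R, continuous g -> \int[mu]_x g x = \int[nu]_x g x) ->
  borel_eq mu nu.
Proof.
move=> H; have [U [oU Udet]] := countable_determining cX; apply: Udet => n.
apply/eqP; rewrite eq_le !weak_open_le// => g cg; exact/esym/H.
Qed.

Lemma empirical_limit_ergodic (f : X -> X) (mu : probability (borel X) R) :
  continuous f -> ergodic_measure f mu ->
  exists G, conull mu G /\ forall x, G x -> borel_eq (empirical_limit f x) mu.
Proof.
move=> cf muE; have [G [cG GP]] := generic_points cX cf muE.
exists G; split => // x Gx; apply: weak_unique => g cg.
have xP : weak_cvg (empirical_measure f x) (empirical_limit f x).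
  by apply: (@getPex _ [set nu | weak_cvg (empirical_measure f x) nu]); exists mu; exact: GP.
exact: (cvg_unique _ (xP g cg) (GP x Gx g cg)).
Qed.

End weak_unique.

(** * Distances between probability measures *)

Section conditional_marginal.
Context {d1 d2 : measure_display} {T1 : measurableType d1} {T2 : measurableType d2}.
Context {R : realType}.
Local Open Scope ereal_scope.

Lemma ge0_integral_mrestr (m : {measure set T1 -> \bar R}) (D : set T1)
    (mD : measurable D) (h : T1 -> \bar R) :
  (forall x, 0 <= h x) -> measurable_fun setT h ->
  \int[mrestr m mD]_x h x = \int[m]_(x in D) h x.
Proof.
move=> h0 mh; rewrite -(setUv D) ge0_integral_setU//; first last.
- exact/disj_setPCl.
- by rewrite setUv.
- exact: measurableC.
rewrite (@eq_measure_integral _ _ _ D m)//; last first.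
  by move=> A mA AD; rewrite /= /mrestr setIidl.
rewrite (@eq_measure_integral _ _ _ (~` D) mzero); last first.
  by move=> A mA AD; rewrite /= /mrestr /mzero (disjoints_subset A D).2 // ?measure0.
by rewrite integral_measure_zero adde0.
Qed.

(** The law of phi conditionally on D.  The product with the mass of D makes the
    formulas hold also when D is null. *)
Lemma conditional_pushforward (pi : probability T1 R) (D : set T1) (phi : T1 -> T2) :
  measurable D -> measurable_fun setT phi ->
  exists P : probability T2 R,
    (forall A, measurable A -> pi D * P A = pi (phi @^-1` A `&` D)) /\
    (forall g : T2 -> \bar R, (forall x, 0 <= g x) -> measurable_fun setT g ->
      pi D * \int[P]_x g x = \int[pi]_(z in D) g (phi z)).
Proof.
move=> mD mphi.
have piD : (fine (pi D))%:E = pi D by rewrite fineK// fin_num_measure.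
have mgphi (g : T2 -> \bar R) : measurable_fun setT g -> measurable_fun setT (g \o phi).
  by move=> mg; exact: measurableT_comp.
have [D0|D0] := eqVneq (pi D) 0.
  exists (\d_point : probability T2 R); split=> [A mA|g g0 mg]; rewrite D0 mul0e.
    apply/esym; apply: (subset_measure0 (B := D)) => //.
    apply: measurableI => //; rewrite -[_ @^-1` _]setTI; exact: mphi.
  apply/esym; apply: null_set_integral => //.
  by apply: measurable_funTS; exact: mgphi.
have t0 : (0 < fine (pi D))%R by rewrite -lte_fin piD lt0e D0 measure_ge0.
have ti0 : (0 <= (fine (pi D))^-1)%R by rewrite invr_ge0 ltW.
pose m_ := mscale (NngNum ti0) (pushforward (mrestr pi mD) phi).
pose m := m_ mphi.
have mE B : m B = ((fine (pi D))^-1%:E * pi (phi @^-1` B `&` D)) by [].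
have [|P PE] := @probability_of_measure _ T2 R m.
  by rewrite [LHS]mE setTI -[X in (_ * X)%E]piD -EFinM mulVf ?gt_eqF.
exists P; split=> [A mA|g g0 mg].
  by rewrite (etrans (PE A) (mE A)) muleA -[X in X * _ * _]piD -EFinM /= mulfV ?gt_eqF// mul1e.
rewrite (@eq_integral_measurable _ _ _ P m) => [|A _]; last exact: PE.
rewrite ge0_integral_mscale// (ge0_integral_pushforward mphi)//.
have gp0 x : 0 <= (g \o phi) x by exact: g0.
rewrite (ge0_integral_mrestr _ _ gp0); last exact: mgphi.
by rewrite muleA -[X in X * _ * _]piD -EFinM /= mulfV ?gt_eqF// mul1e.
Qed.

End conditional_marginal.


Section wasserstein_facts.
Context {R : realType} {X : pmetricType R}.
Hypothesis cX : compact [set: X].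
Implicit Types (mu nu m : probability (borel X) R) (p : R).
Local Open Scope ereal_scope.

Lemma wasserstein_ge0 p mu nu : 0 <= wasserstein p mu nu.
Proof. by apply: le_ereal_inf_tmp => _ [pi _ <-]; exact: poweR_ge0. Qed.

Lemma wasserstein_borel_eq p mu mu' nu : borel_eq mu mu' ->
  wasserstein p mu nu = wasserstein p mu' nu.
Proof.
move=> mm; rewrite /wasserstein (_ : couplings mu nu = couplings mu' nu)//.
by apply/seteqP; split=> pi piP A mA; have [h1 h2] := piP A mA;
  rewrite h1 h2 mm.
Qed.

Lemma measurable_mdist_powR p :
  measurable_fun setT (fun z : borel X * borel X => (mdist (z.1 : X) (z.2 : X) `^ p)%:E).
Proof.
apply/measurable_EFinP.
exact: (measurableT_comp (measurable_powR p) (measurable_mdist cX)).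
Qed.

Lemma wasserstein_sym_le p mu nu : wasserstein p nu mu <= wasserstein p mu nu.
Proof.
apply: le_ereal_inf_tmp => _ [pi piP <-]; apply: ereal_inf_lbound.
pose swap (z : borel X * borel X) := (z.2, z.1).
have msw : measurable_fun setT swap.
  by apply: measurable_fun_pair; [exact: measurable_snd|exact: measurable_fst].
have [P PE] := conditional_pushforward pi measurableT msw.
have [PA PI] := PE.
have {}PA (A : set (borel X * borel X)) : measurable A -> P A = pi (swap @^-1` A).
  by move=> mA; rewrite -(setIT (swap @^-1` A)) -PA// probability_setT mul1e.
have {}PI g (g0 : forall x, 0 <= g x) (mg : measurable_fun setT g) :
    \int[P]_x g x = \int[pi]_z g (swap z).
  by rewrite -PI// probability_setT mul1e.
exists P.
  move=> A mA; have [h1 h2] := piP A mA.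
  rewrite !PA; [|exact: measurableX|exact: measurableX].
  by split; rewrite -?h1 -?h2; congr (pi _); apply/seteqP; split => -[x y] /= [? ?]; split.
congr poweR; apply: etrans (PI (fun z => (mdist (z.1 : X) (z.2 : X) `^ p)%:E) _ _) _.
- by move=> z; rewrite lee_fin powR_ge0.
- exact: measurable_mdist_powR.
- by apply: eq_integral => z _; rewrite /= metric_sym.
Qed.

Lemma wasserstein_sym p mu nu : wasserstein p mu nu = wasserstein p nu mu.
Proof. by apply/eqP; rewrite eq_le !wasserstein_sym_le. Qed.

End wasserstein_facts.

Section partitions.
Context {d : measure_display} {T : measurableType d} {R : realType}.
Local Open Scope ereal_scope.

Lemma measure_total (m : {measure set T -> \bar R}) (D : nat -> set T) (B : set T) :
  (forall j, measurable (D j)) -> trivIset setT D -> \bigcup_j D j = setT ->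
  measurable B -> m B = \sum_(j <oo) m (B `&` D j).
Proof.
move=> mD tD DT mB; rewrite -{1}(setIT B) -DT setI_bigcupr.
rewrite measure_bigcup//; last 2 first.
- by move=> j _; exact: measurableI.
- exact: trivIset_setIl.
by apply: eq_eseriesl => j; rewrite in_setT.
Qed.

End partitions.

Section product_integrals.
Context {d1 d2 : measure_display} {T1 : measurableType d1} {T2 : measurableType d2}.
Context {R : realType}.
Variables (P : probability T1 R) (Q : probability T2 R).
Local Open Scope ereal_scope.

Lemma integral_product_fst (g : T1 -> \bar R) : (forall x, 0 <= g x) ->
  measurable_fun setT g -> \int[P \x Q]_z g z.1 = \int[P]_x g x.
Proof.
move=> g0 mg; rewrite fubini_tonelli1//; last exact: (measurableT_comp mg measurable_fst).
apply: eq_integral => x _; rewrite /fubini_F /=.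
by rewrite (integral_cst Q measurableT) [X in _ * X](@probability_setT _ _ _ Q) mule1.
Qed.

Lemma integral_product_snd (g : T2 -> \bar R) : (forall x, 0 <= g x) ->
  measurable_fun setT g -> \int[P \x Q]_z g z.2 = \int[Q]_x g x.
Proof.
move=> g0 mg; rewrite fubini_tonelli1//; last exact: (measurableT_comp mg measurable_snd).
by rewrite /fubini_F /= (integral_cst P measurableT) [X in _ * X](@probability_setT _ _ _ P) mule1.
Qed.

End product_integrals.

Section powers.
Context {R : realType}.

Lemma powRD_le (a b p : R) : 0 <= a -> 0 <= b -> 0 <= p ->
  (a + b) `^ p <= 2 `^ p * (a `^ p + b `^ p).
Proof.
wlog ab : a b / a <= b => [H a0 b0 p0|a0 b0 p0].
  have [|/ltW] := leP a b => ab; first exact: H.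
  by rewrite addrC [a `^ p + _]addrC; exact: H.
apply: (@le_trans _ _ ((2 * b) `^ p)).
  by apply: ge0_ler_powR; rewrite ?nnegrE ?addr_ge0 ?mulr_ge0//; lra.
by rewrite powRM// ler_wpM2l ?powR_ge0// lerDr powR_ge0.
Qed.

Lemma poweR_root_lt (I : \bar R) (p e : R) : 0 < p -> 0 < e -> (0 <= I)%E ->
  (poweR I p^-1 < e%:E)%E -> (I <= (e `^ p)%:E)%E.
Proof.
move=> p0 e0 I0; apply: contraTT; rewrite -!ltNge -leNgt => eI.
have -> : e%:E = poweR (e `^ p)%:E p^-1.
  by rewrite poweR_EFin -powRrM mulfV ?gt_eqF// powRr1// ltW.
apply: gt0_ler_poweR.
- by rewrite invr_ge0 ltW.
- by rewrite in_itv /= lee_fin powR_ge0 leey.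
- by rewrite in_itv /= I0 leey.
- exact: ltW.
Qed.

Lemma poweR_root_le (I : \bar R) (p e : R) : 0 < p -> 0 < e -> (0 <= I)%E ->
  (I <= (e `^ p)%:E)%E -> (poweR I p^-1 <= e%:E)%E.
Proof.
move=> p0 e0 I0 eI.
have -> : e%:E = poweR (e `^ p)%:E p^-1.
  by rewrite poweR_EFin -powRrM mulfV ?gt_eqF// powRr1// ltW.
apply: gt0_ler_poweR => //.
- by rewrite invr_ge0 ltW.
- by rewrite in_itv /= I0 leey.
- by rewrite in_itv /= lee_fin powR_ge0 leey.
Qed.

End powers.

Section wasserstein_triangle.
Context {R : realType} {X : pmetricType R}.
Hypothesis cX : compact [set: X].
Implicit Types (s m : probability (borel X) R).
Local Open Scope ereal_scope.

(** Given the cell A j of its second coordinate, the first coordinate of the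
    coupling pi has law P j.  Replacing the second coordinate by the reference
    point c j of the cell changes the distance by less than e. *)
Lemma strip_integral_le (p e : R) s m (pi : probability (borel X * borel X)%type R)
    (A : nat -> set (borel X)) (c : nat -> X) (P : nat -> probability (borel X) R) :
  (1 <= p)%R -> (0 < e)%R -> couplings s m pi ->
  (forall j, measurable (A j)) -> trivIset setT A -> \bigcup_j A j = setT ->
  (forall j x, A j x -> (mdist (x : X) (c j) < e)%R) ->
  (forall j g, (forall x, 0 <= g x) -> measurable_fun setT g ->
    pi (setT `*` A j) * \int[P j]_x g x = \int[pi]_(z in setT `*` A j) g z.1) ->
  \sum_(j <oo) (fine (m (A j)))%:E * \int[P j]_x (mdist (x : X) (c j) `^ p)%:E
  <= (2 `^ p)%:E * (\int[pi]_z (mdist (z.1 : X) (z.2 : X) `^ p)%:E + (e `^ p)%:E).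
Proof.
move=> p1 e0 piC mA tA AT Ac HP.
have p0 : (0 <= p)%R by exact: le_trans p1.
pose D j := [set: borel X] `*` A j.
have mD j : measurable (D j) by exact: measurableX.
have mfd := measurable_mdist_powR cX p.
have msum : measurable_fun setT (fun z : borel X * borel X =>
    (mdist (z.1 : X) (z.2 : X) `^ p)%:E + (e `^ p)%:E).
  by apply: emeasurable_funD => //; exact: measurable_cst.
have sum0 (z : borel X * borel X) :
    0 <= (mdist (z.1 : X) (z.2 : X) `^ p)%:E + (e `^ p)%:E.
  by rewrite adde_ge0 ?lee_fin ?powR_ge0.
pose h z := (2 `^ p)%:E * ((mdist (z.1 : X) (z.2 : X) `^ p)%:E + (e `^ p)%:E).
have h0 (z : borel X * borel X) : 0 <= h z.
  by rewrite mule_ge0 ?adde_ge0 ?lee_fin ?powR_ge0.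
have mh : measurable_fun [set: (borel X * borel X)%type] h.
  by apply: emeasurable_funM; first exact: measurable_cst.
have -> : (2 `^ p)%:E * (\int[pi]_z (mdist (z.1 : X) (z.2 : X) `^ p)%:E + (e `^ p)%:E) =
    \sum_(j <oo) \int[pi]_(z in D j) h z.
  rewrite -ge0_integral_bigcup//; last 2 first.
  - exact: measurable_funTS.
  - move=> i j _ _ [[x y] [[_ Ay] [_ Aj]]]; apply: tA => //; by exists y.
  rewrite (_ : \bigcup_j D j = setT); last first.
    apply/seteqP; split=> // -[x y] _.
    have [j _ Ay] : (\bigcup_j A j) y by rewrite AT.
    by exists j.
  have k0 : 0 <= (2 `^ p)%:E :> \bar R by rewrite lee_fin powR_ge0.
  rewrite (ge0_integralZl pi measurableT msum (fun z _ => sum0 z) k0).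
  rewrite ge0_integralD//; last 2 first.
  - by move=> z _; rewrite lee_fin powR_ge0.
  - by move=> z _; rewrite lee_fin powR_ge0.
  by rewrite integral_cst// [X in _ = _ * (_ + _ * X)](@probability_setT _ _ _ pi) mule1.
have md (j : nat) : measurable_fun setT (fun x : borel X => (mdist (x : X) (c j) `^ p)%:E).
  exact: (measurable_fun_pair1 (c j : borel X) mfd).
apply: lee_nneseries => [j _ _|j _].
  by rewrite mule_ge0 ?lee_fin ?fine_ge0// integral_ge0// => x _; rewrite lee_fin powR_ge0.
rewrite fine_prob// -(piC _ (mA j)).2 HP//; last by move=> x; rewrite lee_fin powR_ge0.
apply: ge0_le_integral => //; first exact: (mD j).
- by move=> z _; rewrite lee_fin powR_ge0.
- by apply: measurable_funTS; exact: (measurableT_comp (md j) measurable_fst).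
- exact: measurable_funTS.
move=> [x y] [_ /= Ay]; rewrite /h -EFinD -EFinM lee_fin.
apply: (@le_trans _ _ ((mdist (x : X) (y : X) + e) `^ p)%R).
  apply: ge0_ler_powR; rewrite ?nnegrE ?addr_ge0 ?mdist_ge0 ?(ltW e0)//.
  rewrite (le_trans (metric_triangle x y (c j)))// lerD2l ltW//; exact: Ac Ay.
by apply: powRD_le; rewrite ?mdist_ge0// ltW.
Qed.

(** Glue couplings pi1 of (s, m) and pi2 of (s', m) over a partition A of
    diameter less than e: choose the cell A j with its probability under m, then
    the two coordinates independently, with the laws P j and Q j of the first
    coordinates of pi1 and pi2 given that the second one is in A j.  Distances
    to the reference point c j are compared with pi1 and pi2 by
    [strip_integral_le].  Each of the two uses of [powRD_le] costs a factor
    2 ^ p, and there are four terms e ^ p, whence the constant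
    16 >= 2 * 2 * 4 ^ (1 / p). *)
Lemma wasserstein_quasi_triangle (p e : R) s s' m : (1 <= p)%R -> (0 < e)%R ->
  wasserstein p s m < e%:E -> wasserstein p s' m < e%:E ->
  wasserstein p s s' <= (16 * e)%:E.
Proof.
move=> p1 e0 /ereal_inf_lt[_ [pi1 pi1C <-] I1] /ereal_inf_lt[_ [pi2 pi2C <-] I2].
have p0 : (0 < p)%R by exact: lt_le_trans p1.
have mfd := measurable_mdist_powR cX p.
have Ige0 (pi : probability (borel X * borel X)%type R) :
   0 <= \int[pi]_z (mdist (z.1 : X) (z.2 : X) `^ p)%:E.
  by apply: integral_ge0 => z _; rewrite lee_fin powR_ge0.
move/(poweR_root_lt p0 e0 (Ige0 _)) : I1 => I1.
move/(poweR_root_lt p0 e0 (Ige0 _)) : I2 => I2.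
have [n [A [mA tA _ AT Ae]]] := finite_partition cX e0.
have /choice[c cP] : forall j, exists y : X, forall x, A j x -> A j y.
  move=> j; have [[x Ajx]|nA] := pselect (exists x, A j x).
    by exists x.
  by exists point => x Ax; exfalso; apply: nA; exists x.
have Ac j x : A j x -> (mdist (x : X) (c j) < e)%R.
  by move=> Ax; apply: (Ae j) => //; exact: cP Ax.
have mD (j : nat) : measurable ([set: borel X] `*` A j) by exact: measurableX.
have H (pi : probability (borel X * borel X)%type R) :=
  choice (fun j => conditional_pushforward pi (mD j) (@measurable_fst _ _ (borel X) (borel X))).
have [P PP] := H pi1; have [Q QP] := H pi2.
have w1 : \sum_(j <oo) (fine (m (A j)))%:E = 1.
  rewrite -(@probability_setT _ _ _ m) (measure_total m mA tA AT measurableT).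
  by apply: eq_eseriesr => j _; rewrite setTI fine_prob.
have w0 j : (0 <= fine (m (A j)))%R by rewrite fine_ge0.
have [pi [piE piI]] := mixture_exists (fun j => (P j \x Q j)%E) w0 w1.
have wE1 j : (fine (m (A j)))%:E = pi1 (setT `*` A j).
  by rewrite fine_prob// (pi1C _ (mA j)).2.
have wE2 j : (fine (m (A j)))%:E = pi2 (setT `*` A j).
  by rewrite fine_prob// (pi2C _ (mA j)).2.
have tD : trivIset setT (fun j => [set: borel X] `*` A j).
  by move=> i j _ _ [[x y] [[_ Ay] [_ Aj]]]; apply: tA => //; exists y.
have DT : \bigcup_j ([set: borel X] `*` A j) = setT.
  apply/seteqP; split=> // -[x y] _.
  have [j _ Ay] : (\bigcup_j A j) y by rewrite AT.
  by exists j.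
have piC : couplings s s' pi.
  move=> B mB; have mBX : measurable (B `*` [set: borel X]) by exact: measurableX.
  split; rewrite piE.
    rewrite -(pi1C _ mB).1 (measure_total pi1 mD tD DT mBX).
    apply: eq_eseriesr => j _; rewrite wE1.
    rewrite [X in _ * X](product_measure1E (P j) (Q j) mB measurableT).
    rewrite [X in _ * (_ * X)](@probability_setT _ _ _ (Q j)) mule1.
    apply: etrans ((PP j).1 B mB) _; congr (pi1 _).
    by apply/seteqP; split => -[x y] /= [] => [? [? ?]|[? ?] [? ?]]; split.
  rewrite -(pi2C _ mB).1 (measure_total pi2 mD tD DT mBX).
  apply: eq_eseriesr => j _; rewrite wE2.
  rewrite [X in _ * X](product_measure1E (P j) (Q j) measurableT mB).
  rewrite [X in _ * (X * _)](@probability_setT _ _ _ (P j)) mul1e.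
  apply: etrans ((QP j).1 B mB) _; congr (pi2 _).
  by apply/seteqP; split => -[x y] /= [] => [? [? ?]|[? ?] [? ?]]; split.
apply: (@le_trans _ _ (poweR (\int[pi]_z (mdist (z.1 : X) (z.2 : X) `^ p)%:E) p^-1)).
  by apply: ereal_inf_lbound; exists pi.
apply: poweR_root_le => //; first by rewrite mulr_gt0.
rewrite piI//; last by move=> z; rewrite lee_fin powR_ge0.
have md (j : nat) : measurable_fun setT (fun x : borel X => (mdist (x : X) (c j) `^ p)%:E).
  exact: (measurable_fun_pair1 (c j : borel X) mfd).
have d0 (j : nat) (x : X) : 0 <= (mdist x (c j) `^ p)%:E by rewrite lee_fin powR_ge0.
have S1 := strip_integral_le p1 e0 pi1C mA tA AT Ac (fun j => (PP j).2).
have S2 := strip_integral_le p1 e0 pi2C mA tA AT Ac (fun j => (QP j).2).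
set K := (2 `^ p)%:E in S1 S2.
have K0 : 0 <= K by rewrite lee_fin powR_ge0.
apply: (@le_trans _ _ (\sum_(j <oo) K *
    ((fine (m (A j)))%:E * \int[P j]_x (mdist (x : X) (c j) `^ p)%:E +
     (fine (m (A j)))%:E * \int[Q j]_x (mdist (x : X) (c j) `^ p)%:E))).
  apply: lee_nneseries => [j _ _|j _].
    by rewrite mule_ge0 ?lee_fin// integral_ge0// => z _; rewrite lee_fin powR_ge0.
  rewrite -muleDr//; last by rewrite ge0_adde_def// inE; apply: integral_ge0 => x _; exact: d0.
  rewrite muleCA lee_wpmul2l ?lee_fin//.
  rewrite -(@integral_product_fst _ _ _ _ _ (P j) (Q j) _ (d0 j) (md j)).
  rewrite -(@integral_product_snd _ _ _ _ _ (P j) (Q j) _ (d0 j) (md j)).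
  have m1 : measurable_fun setT (fun z : borel X * borel X => (mdist (z.1 : X) (c j) `^ p)%:E).
    exact: (measurableT_comp (md j) measurable_fst).
  have m2 : measurable_fun setT (fun z : borel X * borel X => (mdist (z.2 : X) (c j) `^ p)%:E).
    exact: (measurableT_comp (md j) measurable_snd).
  rewrite -ge0_integralD//.
  rewrite -ge0_integralZl//; last 2 first.
  - exact: emeasurable_funD.
  - by move=> z _; rewrite adde_ge0.
  apply: ge0_le_integral => //.
  - by move=> z _; rewrite lee_fin powR_ge0.
  - by apply: emeasurable_funM; [exact: measurable_cst|exact: emeasurable_funD].
  move=> [x y] _ /=; rewrite -EFinD -EFinM lee_fin.
  apply: (@le_trans _ _ ((mdist (x : X) (c j) + mdist (y : X) (c j)) `^ p)%R).
    apply: ge0_ler_powR; rewrite ?nnegrE ?addr_ge0 ?mdist_ge0// ?(ltW p0)//.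
    by rewrite (metric_sym (y : X)); exact: metric_triangle.
  by apply: powRD_le; rewrite ?mdist_ge0// ltW.
have t0 (S : nat -> probability (borel X) R) (j : nat) :
    0 <= (fine (m (A j)))%:E * \int[S j]_x (mdist (x : X) (c j) `^ p)%:E.
  by rewrite mule_ge0 ?lee_fin// integral_ge0// => x _; exact: d0.
rewrite nneseriesZl; last by move=> j _; rewrite adde_ge0.
rewrite nneseriesD//.
apply: (@le_trans _ _ (K * (K * ((e `^ p)%:E + (e `^ p)%:E) + K * ((e `^ p)%:E + (e `^ p)%:E)))).
  apply: lee_wpmul2l => //; apply: leeD.
    by apply: (le_trans S1); apply: lee_wpmul2l => //; exact: leeD.
  by apply: (le_trans S2); apply: lee_wpmul2l => //; exact: leeD.
change (((2 `^ p) * ((2 `^ p) * (e `^ p + e `^ p) + (2 `^ p) * (e `^ p + e `^ p)))%:E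
  <= ((16 * e) `^ p)%:E).
rewrite lee_fin.
have -> : (16 * e = 2 * (2 * (4 * e)))%R by ring.
rewrite !powRM ?mulr_ge0 ?(ltW e0)//.
have h4 : (4 <= 4 `^ p :> R)%R by apply: le1r_powR => //; lra.
have k0 : (0 <= 2 `^ p :> R)%R by exact: powR_ge0.
have ep0 : (0 <= e `^ p)%R by exact: powR_ge0.
apply: ler_wpM2l => //; rewrite -mulrDr; apply: ler_wpM2l => //.
apply: (le_trans _ (ler_wpM2r ep0 h4)).
lra.
Qed.

End wasserstein_triangle.

(** What the Wasserstein and the Levy-Prokhorov distances have in common, and all
    that is used of them.  Points close to the same center are close to each other; the constant
    K is immaterial at the logarithmic scale of emergence. *)
Record emergence_metric (R : realType) (X : pmetricType R)
    (dist : probability (borel X) R -> probability (borel X) R -> \bar R) : Prop :=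
  EmergenceMetric {
  em_ge0 : forall mu nu, (0 <= dist mu nu)%E ;
  em_borel_eq : forall mu mu' nu, borel_eq mu mu' -> dist mu nu = dist mu' nu ;
  em_sym : forall mu nu, dist mu nu = dist nu mu ;
  em_quasi_triangle : exists2 K : R, 0 < K & forall e s s' m, 0 < e ->
    (dist s m < e%:E)%E -> (dist s' m < e%:E)%E -> (dist s s' <= (K * e)%:E)%E }.

Section distances_are_emergence_metrics.
Context {R : realType} {X : pmetricType R}.
Hypothesis cX : compact [set: X].
Local Open Scope ereal_scope.

Lemma wasserstein_emergence_metric (p : R) : (1 <= p)%R ->
  emergence_metric (@wasserstein R X p).
Proof.
move=> p1; split.
- exact: wasserstein_ge0.
- exact: wasserstein_borel_eq.
- by move=> mu nu; exact: wasserstein_sym.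
- exists 16%R => // e s s' m e0; exact: wasserstein_quasi_triangle.
Qed.

Lemma neighborhoodD (a b : R) (E : set X) :
  neighborhood a (neighborhood b E) `<=` neighborhood (b + a) E.
Proof.
move=> x [y [z Ez zy] yx]; exists z => //; exact: ball_triangle zy yx.
Qed.

Lemma levy_prokhorov_emergence_metric : emergence_metric (@levy_prokhorov R X).
Proof.
have mN (e : R) (E : set X) : measurable (neighborhood e E : set (borel X)).
  by apply: open_borel; exact: open_neighborhood.
have chain (m1 m2 m3 : probability (borel X) R) (a b : R) :
    (forall E : set (borel X), measurable E -> m1 E <= m2 (neighborhood a E) + a%:E) ->
    (forall E : set (borel X), measurable E -> m2 E <= m3 (neighborhood b E) + b%:E) ->
    forall E : set (borel X), measurable E -> m1 E <= m3 (neighborhood (a + b) E) + (a + b)%:E.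
  move=> h12 h23 E mE; apply: (le_trans (h12 E mE)).
  rewrite [(a + b)%R]addrC EFinD addeA leeD2r//.
  apply: (le_trans (h23 _ (mN a E))); rewrite leeD2r// le_measure ?inE//.
  by rewrite addrC; exact: neighborhoodD.
split.
- by move=> mu nu; apply: le_ereal_inf_tmp => _ [e [e0 _] <-]; rewrite lee_fin ltW.
- move=> mu mu' nu mm; rewrite /levy_prokhorov; congr (ereal_inf (_ @` _)).
  apply/seteqP; split=> e [e0 H]; split => // E mE; have [h1 h2] := H E mE.
    by rewrite -!mm.
  by rewrite !mm.
- move=> mu nu; rewrite /levy_prokhorov; congr (ereal_inf (_ @` _)).
  by apply/seteqP; split=> e [e0 H]; split => // E mE; have [h1 h2] := H E mE.
- exists 2%R => // e s s' m e0.
  move=> /ereal_inf_lt[_ [a [a0 Ha] <-] ae] /ereal_inf_lt[_ [b [b0 Hb] <-] be].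
  apply: (@le_trans _ _ (a + b)%:E); last first.
    by rewrite lte_fin in ae; rewrite lte_fin in be; rewrite lee_fin; lra.
  apply: ereal_inf_lbound; exists (a + b)%R => //; split; first exact: addr_gt0.
  move=> E mE; split.
    rewrite [(a + b)%R]addrC; apply: (chain s' m s) => // F mF.
      by have [] := Hb F mF.
    by have [] := Ha F mF.
  apply: (chain s m s') => // F mF.
    by have [] := Ha F mF.
  by have [] := Hb F mF.
Qed.

End distances_are_emergence_metrics.

(** * The mixture over scales *)

Section least_facts.
Context {R : realType}.
Local Open Scope ereal_scope.
Implicit Types A : set nat.

Lemma least_le A n : A n -> least A <= n%:R%:E :> \bar R.
Proof. by move=> An; apply: ereal_inf_lbound; exists n. Qed.

Lemma le_least A (x : \bar R) : (forall n, A n -> x <= n%:R%:E) -> x <= least A.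
Proof. by move=> h; apply: le_ereal_inf_tmp => _ [n An <-]; exact: h. Qed.

Lemma leastP A : least A = +oo :> \bar R \/
  exists n, least A = n%:R%:E :> \bar R.
Proof.
have [[n An]|nA] := pselect (exists n, A n); last first.
  left; apply/eqP; rewrite -leye_eq; apply: le_least => n An.
  by exfalso; apply: nA; exists n.
right.
have ex : exists n, `[< A n >] by exists n; apply/asboolP.
have [m /asboolP Am mmin] := ex_minnP ex.
exists m; apply/eqP; rewrite eq_le least_le//=.
by apply: le_least => k Ak; rewrite lee_fin ler_nat mmin//; exact/asboolP.
Qed.

End least_facts.

Section separated.
Context {R : realType} {X : pmetricType R}.
Variable dist : probability (borel X) R -> probability (borel X) R -> \bar R.
Variable f : X -> X.
Local Open Scope ereal_scope.

(** Greedy choice: fewer balls than the topological emergence do not cover. *)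
Lemma separated_ergodic (e : R) (N : nat) :
  N%:R%:E <= topological_emergence dist f e ->
  exists s : nat -> probability (borel X) R,
    (forall i, (i < N)%N -> ergodic_measure f (s i)) /\
    (forall i j, (i < j < N)%N -> e%:E < dist (s i) (s j)).
Proof.
elim: N => [_|N IH HN].
  by exists (fun=> \d_point : probability (borel X) R); split => // i j /andP[].
have [|s [sE sd]] := IH.
  by apply: le_trans HN; rewrite lee_fin ler_nat.
have /existsNP[nu /not_implyP[nuE nnu]] : ~ ([set nu | ergodic_measure f nu] `<=`
    \bigcup_(i in [set: 'I_N]) [set nu | dist (s i) nu <= e%:E]).
  move=> H; have : topological_emergence dist f e <= N%:R%:E.
    by apply: least_le; exists (fun i : 'I_N => s i).
  by move=> /(le_trans HN); rewrite lee_fin ler_nat ltnn.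
exists (fun i => if (i < N)%N then s i else nu); split=> [i iN|i j /andP[ij jN]].
  by case: ifP => // iN'; exact: sE.
rewrite (leq_trans ij); last by rewrite -ltnS.
case: ifP => jN'; first by apply: sd; rewrite ij.
have iN : (i < N)%N by rewrite (leq_trans ij)// -ltnS.
rewrite ltNge; apply/negP => h; apply: nnu; by exists (Ordinal iN).
Qed.

End separated.

(** For P i a meaning that the point i is close to the center a: points of which
    no two share a center are at most as many as the centers. *)
Lemma card_pigeonhole (n N : nat) (P : 'I_n -> 'I_N -> bool) :
  (forall i j a, P i a -> P j a -> i = j) ->
  (#|[set i | [exists a, P i a]]%SET| <= N)%N.
Proof.
move=> Pinj; pose F i := [pick a | P i a].
have Finj : {in [set i | [exists a, P i a]]%SET &, injective F}.
  move=> i j; rewrite !inE => /existsP[a Pia] /existsP[b Pjb]; rewrite /F.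
  case: pickP => [a' Pa'|/(_ a)]; last by rewrite Pia.
  case: pickP => [b' Pb'|/(_ b)]; last by rewrite Pjb.
  by move=> [ab]; rewrite ab in Pa'; exact: Pinj Pa' Pb'.
rewrite -(card_in_imset Finj).
apply: (@leq_trans #|[set Some a | a : 'I_N]%SET|); last first.
  by rewrite card_imset ?card_ord// => a b [].
apply/subset_leq_card/fintype.subsetP => o /imsetP[i]; rewrite inE => /existsP[a Pia] ->.
rewrite /F; case: pickP => [b _|/(_ a)]; last by rewrite Pia.
exact: imset_f.
Qed.

Section scale_weights.
Context {R : realType}.

(** Telescoping, with sum 1, and decaying slower than any exponential. *)
Definition scale_weight (k : nat) : R := (k.+1%:R * k.+2%:R)^-1.

Lemma scale_weight_gt0 k : 0 < scale_weight k.
Proof. by rewrite invr_gt0 mulr_gt0. Qed.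

Lemma scale_weight_sum : (\sum_(k <oo) (scale_weight k)%:E = 1)%E.
Proof.
have part n : \sum_(0 <= k < n) scale_weight k = 1 - n.+1%:R^-1.
  elim: n => [|n IH]; first by rewrite big_geq// invr1 subrr.
  rewrite big_nat_recr//= IH /scale_weight.
  rewrite -[n.+2%:R]natr1; have : n.+1%:R != 0 :> R by rewrite pnatr_eq0.
  have : n.+1%:R + 1 != 0 :> R by rewrite natr1 pnatr_eq0.
  by move: (n.+1%:R : R) => u h1 h2; field; rewrite h1 h2.
apply/cvg_lim => //.
rewrite (_ : (fun n => _) = (fun n => (1 - n.+1%:R^-1)%:E)); last first.
  by apply/funext => n; rewrite sumEFin part.
apply/cvg_EFin; first exact: nearW.
rewrite -[X in _ --> X]subr0; apply: cvgB; first exact: cvg_cst.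
exact: cvg_harmonic.
Qed.

Lemma uniform_weight_sum (n : nat) : (0 < n)%N ->
  (\sum_(i <oo) (if (i < n)%N then n%:R^-1 else 0 : R)%:E = 1)%E.
Proof.
move=> n0; rewrite (nneseries_split 0 n)//; last first.
  by move=> k _; case: ifP => _; rewrite lee_fin ?invr_ge0.
rewrite add0n [X in (_ + X)%E]eseries0 ?adde0; last first.
  by move=> i ni _; rewrite ltnNge ni.
rewrite big_mkord (eq_bigr (fun=> (n%:R^-1)%:E)); last by move=> i _; rewrite ltn_ord.
by rewrite sumEFin sumr_const card_ord -[X in X%:E]mulr_natl divff// pnatr_eq0 -lt0n.
Qed.

End scale_weights.

Section mixture_emergence.
Context {R : realType} {X : pmetricType R}.
Hypothesis cX : compact [set: X].
Variable dist : probability (borel X) R -> probability (borel X) R -> \bar R.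
Hypothesis distM : emergence_metric dist.
Variable f : X -> X.
Hypothesis cf : continuous f.
Local Open Scope ereal_scope.

Lemma metric_emergence_ge1 (mu : probability (borel X) R) (e : R) :
  1 <= metric_emergence dist f mu e.
Proof.
apply: le_least => -[|n] [m]; last by rewrite lee_fin ler1n.
under eq_integral do rewrite big_ord0.
by rewrite (integral_cst mu measurableT +oo) [X in _ * X](@probability_setT _ _ _ mu) mule1.
Qed.

(** This is where the existence of an ergodic measure enters. *)
Lemma topological_emergence_ge1 (e : R) : 1 <= topological_emergence dist f e.
Proof.
have [nu nuE] := ergodic_exists cX cf.
apply: le_least => -[|n] [m H]; last by rewrite lee_fin ler1n.
by have [[]] := H nu nuE.
Qed.

Lemma topological_emergence_le (e e' : R) : (e <= e')%R ->
  topological_emergence dist f e' <= topological_emergence dist f e.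
Proof.
move=> ee; apply: le_least => n [c H]; apply: least_le; exists c => nu /H[i _ ci].
by exists i => //=; rewrite (le_trans ci)// lee_fin.
Qed.

Variables (N : nat -> nat) (s : nat -> nat -> probability (borel X) R).
Hypothesis N0 : forall k, (0 < N k)%N.
Hypothesis sE : forall k i, (i < N k)%N -> ergodic_measure f (s k i).

Lemma scale_mixture_exists : exists mu : probability (borel X) R,
  [/\ invariant_measure f mu,
   forall A, (forall k i, (i < N k)%N -> s k i A = 0) -> mu A = 0 &
   forall k A, measurable A ->
     (scale_weight k)%:E * \sum_(i < N k) ((N k)%:R^-1)%:E * s k i A <= mu A].
Proof.
pose w k i : R := (if (i < N k)%N then (N k)%:R^-1 else 0)%R.
have w0 k i : (0 <= w k i)%R by rewrite /w; case: ifP => _; rewrite ?invr_ge0.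
have [t tP] := choice (fun k => mixture_exists (s k) (w0 k) (uniform_weight_sum (N0 k))).
have c0 k := ltW (@scale_weight_gt0 R k).
have [mu [muE _]] := mixture_exists t c0 scale_weight_sum.
exists mu; split.
- move=> A mA; rewrite !muE; apply: eq_eseriesr => k _; congr (_ * _).
  rewrite !(tP k).1; apply: eq_eseriesr => i _; rewrite /w.
  by case: ifP => [iN|_]; rewrite ?mul0e// (sE iN).1.
- move=> A sA; rewrite muE eseries0// => k _ _.
  rewrite (tP k).1 eseries0 ?mule0// => i _ _; rewrite /w.
  by case: ifP => iN; rewrite ?mul0e// sA ?mule0.
- move=> k A mA; rewrite muE.
  have S0 j : 0 <= (scale_weight j)%:E * t j A :> \bar R by rewrite mule_ge0 ?lee_fin.
  apply: (@le_trans _ _ (\sum_(0 <= j < k.+1) (scale_weight j)%:E * t j A)); last first.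
    by apply: nneseries_lim_ge.
  rewrite big_nat_recr//=.
  apply: (@le_trans _ _ ((scale_weight k)%:E * t k A)); last first.
    by rewrite leeDr//; apply: sume_ge0 => j _.
  rewrite lee_wpmul2l ?lee_fin// (tP k).1.
  apply: (@le_trans _ _ (\sum_(0 <= i < N k) (w k i)%:E * s k i A)); last first.
    by apply: nneseries_lim_ge => i _ _; rewrite mule_ge0 ?lee_fin.
  by rewrite big_mkord; apply: lee_sum => i _; rewrite /w ltn_ord.
Qed.

Variable mu : probability (borel X) R.
Hypothesis mu_null : forall A, (forall k i, (i < N k)%N -> s k i A = 0) -> mu A = 0.
Hypothesis mu_lb : forall k A, measurable A ->
  (scale_weight k)%:E * \sum_(i < N k) ((N k)%:R^-1)%:E * s k i A <= mu A.

Lemma min_dist_ge0 n (nu : probability (borel X) R) (m : 'I_n -> probability (borel X) R) :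
  0 <= \big[Order.min/+oo]_(i < n) dist nu (m i).
Proof. by elim/big_ind: _ => // [x y x0 y0|i _]; [rewrite le_min x0|exact: em_ge0]. Qed.

Lemma basins : exists G : nat -> nat -> set (borel X), forall k i, measurable (G k i) /\
  ((i < N k)%N -> s k i (~` G k i) = 0 /\
    forall x, G k i x -> borel_eq (empirical_limit f x) (s k i)).
Proof.
have H k i : exists G : set (borel X), measurable G /\ ((i < N k)%N -> s k i (~` G) = 0 /\
    forall x, G x -> borel_eq (empirical_limit f x) (s k i)).
  have [iN|iN] := boolP (i < N k)%N; last by exists setT; split.
  have [G [[mG G0] GP]] := empirical_limit_ergodic cX cf (sE iN).
  by exists G; split.
by have [G GP] := choice (fun k => let: existT g gP := choice (H k) in ex_intro _ g gP); exists G.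
Qed.

Lemma metric_emergence_le_topological (e : R) : (0 <= e)%R ->
  metric_emergence dist f mu e <= topological_emergence dist f e.
Proof.
move=> e0; have [G GP] := basins.
apply: le_least => n [c H]; apply: least_le; exists c.
pose G' k i := if (i < N k)%N then G k i else set0.
have mG' k i : measurable (G' k i).
  by rewrite /G'; case: ifP => _; [exact: (GP k i).1|exact: measurable0].
pose GG : set (borel X) := \bigcup_k \bigcup_i G' k i.
have mGG : measurable GG.
  by apply: bigcup_measurable => k _; apply: bigcup_measurable => i _.
rewrite -[leRHS]mule1 -[X in _ * X](@probability_setT _ _ _ mu).
apply: (@integral_ub_conull _ _ _ _ _ GG) => //.
- by move=> x; exact: min_dist_ge0.
- apply: mu_null => k i iN; apply: (subset_measure0 (B := ~` G k i)).
  + exact: measurableC.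
  + by apply: measurableC; exact: (GP k i).1.
  + by move=> x nGG Gx; apply: nGG; exists k => //; exists i => //; rewrite /G' iN.
  + by have [] := (GP k i).2 iN.
move=> x [k _ [i _]]; rewrite /G'; case: ifP => // iN Gx.
have [_ /(_ _ Gx) xs] := (GP k i).2 iN.
have [a _ /= ca] := H _ (sE iN).
apply: le_trans ca; rewrite (em_sym distM) -(em_borel_eq distM _ xs).
exact: bigmin_le.
Qed.

(** Call far the indices i such that s k i is at distance at least r from every
    center.  As the measures of scale k are K * r separated, each center is
    r-close to at most one of them, so there are at least N k - n far indices.
    On the union B of the corresponding basins the integrand is at least r, and
    the mass of B is at least the weight of the scale times the proportion of far
    indices. *)
Lemma metric_emergence_ge_half (K : R) (k : nat) (r e : R) :
  (0 < r)%R ->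
  (forall e s s' m, (0 < e)%R -> dist s m < e%:E -> dist s' m < e%:E ->
     dist s s' <= (K * e)%:E) ->
  (forall i j, (i < j < N k)%N -> (K * r)%:E < dist (s k i) (s k j)) ->
  (2 * e < r * scale_weight k)%R ->
  ((N k)%:R / 2)%:E <= metric_emergence dist f mu e.
Proof.
move=> r0 tri sep er; have [G GP] := basins.
apply: le_least => n [m H]; rewrite lee_fin.
pose near (i : 'I_(N k)) (a : 'I_n) := `[< dist (s k i) (m a) < r%:E >].
have sepN (i j : 'I_(N k)) a : (i < j)%N -> near i a -> near j a -> False.
  move=> ij /asboolP ia /asboolP ja.
  have := tri _ _ _ _ r0 ia ja; rewrite leNgt => /negP; apply.
  by apply: sep; rewrite ij ltn_ord.
have card_near : (#|[set i | [exists a, near i a]]%SET| <= n)%N.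
  apply: card_pigeonhole => i j a ia ja; apply/val_inj => /=.
  by case: (ltngtP i j) => // ij; exfalso; [exact: sepN ij ia ja|exact: sepN ij ja ia].
pose far : {set 'I_(N k)} := (~: [set i | [exists a, near i a]])%SET.
have card_far : (N k <= #|far| + n)%N.
  by rewrite -[leqLHS]card_ord -(cardsC [set i | [exists a, near i a]]%SET) addnC leq_add2l.
pose B : set (borel X) := \bigcup_(i in [set i : 'I_(N k) | i \in far]) G k i.
have mB : measurable B.
  by apply: fin_bigcup_measurable => [|i _]; [exact: finite_finset|exact: (GP k i).1].
have FB x : B x -> r%:E <= \big[Order.min/+oo]_(i < n) dist (empirical_limit f x) (m i).
  move=> [i /= ifar Gx]; have [_ /(_ _ Gx) xs] := (GP k i).2 (ltn_ord i).
  elim/big_ind: _ => [|u v ru rv|a _]; [exact: leey|by rewrite le_min ru|].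
  rewrite (em_borel_eq distM _ xs) leNgt; apply/negP => lt.
  by move: ifar; rewrite !inE => /negP; apply; apply/existsP; exists a; exact/asboolP.
have r0' := ltW r0.
have c0 := ltW (@scale_weight_gt0 R k).
have Nk0 : (0 < (N k)%:R :> R)%R by rewrite ltr0n.
have muB : (scale_weight k * (#|far|%:R / (N k)%:R))%:E <= mu B.
  apply: le_trans (mu_lb k mB); rewrite EFinM lee_wpmul2l ?lee_fin//.
  rewrite -ge0_sume_distrr; last by move=> i _.
  rewrite [(_ / _)%R]mulrC EFinM lee_wpmul2l ?lee_fin ?invr_ge0//.
  apply: (@le_trans _ _ (\sum_(i < N k | i \in far) s k i B)); last first.
    by rewrite big_mkcond /=; apply: lee_sum => i _; case: ifP.
  rewrite (eq_bigr (fun=> 1%:E)) => [|i ifar].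
    by rewrite sumEFin sumr_const.
  apply/eqP; rewrite eq_le probability_le1//=.
  have [Gi0 _] := (GP k i).2 (ltn_ord i).
  have <- : s k i (G k i) = 1 by apply: conull1; split; [exact: (GP k i).1|].
  by apply: le_measure; rewrite ?inE//; [exact: (GP k i).1|move=> x Gx; exists i].
have := le_trans (@integral_lb_set _ _ _ mu _ B r r0' (fun x => min_dist_ge0 _ m) mB FB) H.
move/(le_trans (lee_wpmul2l (_ : 0 <= r%:E) muB)); rewrite lee_fin => /(_ r0').
rewrite -EFinM lee_fin => rfe.
rewrite -(ler_nat R) natrD in card_far.
rewrite leNgt; apply/negP => nN.
have far_half : ((N k)%:R / 2 <= #|far|%:R :> R)%R by lra.
have : (r * (scale_weight k * (1 / 2)) <= r * (scale_weight k * (#|far|%:R / (N k)%:R)))%R.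
  by rewrite !ler_wpM2l// ler_pdivlMr// mul1r mulrC.
move: (scale_weight k) er rfe c0 => c er rfe c0; lra.
Qed.

End mixture_emergence.

(** * Upper and lower limits at zero *)

Section limf_facts.
Context {R : realType}.
Implicit Types (g h : R -> \bar R) (c : \bar R).
Local Open Scope ereal_scope.

Lemma limf_esup_le (F : set_system R) g c : (\forall e \near F, g e <= c) ->
  limf_esup g F <= c.
Proof.
move=> gc; apply: ge_ereal_inf; exists (ereal_sup [set g x | x in [set e | g e <= c]]).
  by exists [set e | g e <= c].
by apply: ge_ereal_sup => _ [e /= ge <-].
Qed.

Lemma limf_esup_lt (F : set_system R) g c : Filter F -> limf_esup g F < c ->
  \forall e \near F, g e < c.
Proof.
move=> FF /ereal_inf_lt[_ [V FV <-]] supc.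
apply: filterS FV => e Ve; apply: le_lt_trans supc.
by apply: ereal_sup_ubound; exists e.
Qed.

Lemma limf_einf_ge (F : set_system R) g c : Filter F -> (\forall e \near F, c <= g e) ->
  c <= limf_einf g F.
Proof.
move=> FF gc; rewrite /limf_einf leeNr; apply: limf_esup_le.
by apply: filterS gc => e; rewrite leeN2.
Qed.

Lemma limf_einf_gt (F : set_system R) g c : Filter F -> c < limf_einf g F ->
  \forall e \near F, c < g e.
Proof.
move=> FF; rewrite /limf_einf lteNr => /limf_esup_lt h.
by apply: filterS h => e; rewrite lteN2.
Qed.

(** Equalities between limits are reduced to eventual inequalities with real
    bounds by this lemma, its dual, [limf_esup_lt] and [limf_einf_gt]. *)
Lemma le_of_real_ub (x y : \bar R) : (forall c : R, x < c%:E -> y <= c%:E) -> y <= x.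
Proof.
case: x => [r| |] H; last 2 first.
- by rewrite leey.
- rewrite leeNy_eq; apply/eqP; case: y H => [y| |] H //.
    by have := H (y - 1)%R (ltNyr _); rewrite lee_fin lerBrDr gerDl ler10.
  by have := H 0%R (ltNyr _).
apply/lee_addgt0Pr => e e0; rewrite -EFinD; apply: H.
by rewrite lte_fin ltrDl.
Qed.

Lemma le_of_real_lb (x y : \bar R) : (forall c : R, c%:E < x -> c%:E <= y) -> x <= y.
Proof.
move=> H; rewrite -leeN2; apply: le_of_real_ub => c; rewrite lteNl -EFinN => /H.
by rewrite leeNl.
Qed.

Lemma limf_esup_mono (F : set_system R) g h : Filter F ->
  (\forall e \near F, g e <= h e) -> limf_esup g F <= limf_esup h F.
Proof.
move=> FF gh; apply: le_of_real_ub => c /limf_esup_lt hc; apply: limf_esup_le.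
by apply: filterS2 gh hc => e ge he; rewrite (le_trans ge)// ltW.
Qed.

Lemma limf_einf_mono (F : set_system R) g h : Filter F ->
  (\forall e \near F, g e <= h e) -> limf_einf g F <= limf_einf h F.
Proof.
move=> FF gh; apply: le_of_real_lb => c /limf_einf_gt hc; apply: limf_einf_ge.
by apply: filterS2 gh hc => e ge he; rewrite (le_trans _ ge)// ltW.
Qed.

Lemma limf_einf_le_esup (F : set_system R) g : ProperFilter F ->
  limf_einf g F <= limf_esup g F.
Proof.
move=> FF; apply: le_of_real_lb => c /limf_einf_gt gc.
apply: le_of_real_ub => d /limf_esup_lt gd.
have [e [ce ed]] := filter_ex (filterI gc gd).
exact: ltW (lt_trans ce ed).
Qed.

(** The substitution e = exp (- x), in which - ln e is x and e ^ (1 + eta) is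
    the dilation (1 + eta) * x. *)
Lemma near0P (P : R -> Prop) :
  (\forall e \near (0 : R)^'+, P e) <->
  exists x0 : R, forall x : R, (x0 < x)%R -> P (expR (- x)).
Proof.
split.
  rewrite near_withinE => /nbhs_ballP[d /= d0 H].
  exists (- ln d)%R => x dx; apply: H; last exact: expR_gt0.
  rewrite -ball_normE /= sub0r normrN gtr0_norm ?expR_gt0//.
  by rewrite -[ltRHS]lnK ?posrE// ltr_expR ltrNl.
move=> [x0 H]; rewrite near_withinE; apply/nbhs_ballP.
exists (expR (- x0)); first exact: expR_gt0.
move=> e; rewrite -ball_normE /= sub0r normrN => ed e0.
rewrite gtr0_norm// in ed.
rewrite -[e]lnK ?posrE// -[ln e]opprK; apply: H.
by rewrite ltrNr -ltr_expR lnK.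
Qed.

End limf_facts.

Section quotient.
Context {R : realType}.
Implicit Types (F : R -> \bar R) (x r : R).

Lemma quotient_fin F x r : 0 < x -> 1 < r -> F (expR (- x)) = r%:E ->
  (emergence_quotient F (expR (- x)) = ((ln (ln r)) / x)%:E)%E.
Proof.
move=> x0 r1 Fr; rewrite /emergence_quotient Fr eqe gt_eqF//.
rewrite lne_EFin ?(lt_trans ltr01)// lne_EFin ?ln_gt0//.
by rewrite expRK opprK inver gt_eqF.
Qed.

Lemma quotient_y F x : 0 < x -> F (expR (- x)) = +oo%E ->
  emergence_quotient F (expR (- x)) = +oo%E.
Proof.
move=> x0 Fy; rewrite /emergence_quotient Fy /= expRK opprK inver gt_eqF//.
by rewrite gt0_mulye// lte_fin invr_gt0.
Qed.

Lemma quotient_1 F (e : R) : F e = 1%E -> emergence_quotient F e = 0%E.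
Proof. by move=> F1; rewrite /emergence_quotient F1 eqxx. Qed.

(** Emergences are positive integers or infinite.  Without a gap after 1, the double
    logarithm would be unbounded below. *)
Definition emergence_valued F := forall e : R, F e = 1%E \/ (2%:E <= F e)%E.

(** The double logarithm stays between two constants while - ln e grows. *)
Lemma quotient_limits_bounded F (M : R) : emergence_valued F ->
  (forall e, 0 < e -> (F e <= M%:E)%E) ->
  limf_esup (emergence_quotient F) (0 : R)^'+ = 0%E /\
  limf_einf (emergence_quotient F) (0 : R)^'+ = 0%E.
Proof.
move=> F2 FM.
pose C := `|ln (ln 2)| + `|ln (ln (Num.max M 2))| + 1 : R.
have C0 : 0 < C by rewrite /C ltr_pwDr// addr_ge0.
have bound x : 0 < x -> ((- (C / x))%:E <= emergence_quotient F (expR (- x)))%E /\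
    (emergence_quotient F (expR (- x)) <= (C / x)%:E)%E.
  move=> x0; have [F1|F2x] := F2 (expR (- x)).
    by rewrite quotient_1// !lee_fin oppr_le0 divr_ge0// ltW.
  have FMx := FM _ (expR_gt0 (- x)).
  have [r Fr] : exists r : R, F (expR (- x)) = r%:E.
    by case: (F _) F2x FMx => // r _ _; exists r.
  rewrite Fr lee_fin in F2x; rewrite Fr lee_fin in FMx.
  have r1 : 1 < r by lra.
  rewrite (quotient_fin x0 r1 Fr) !lee_fin -mulNr !ler_pM2r ?invr_gt0//.
  have l2 : 0 < ln 2 :> R by rewrite ln_gt0// ltr1n.
  have lr : 0 < ln r by rewrite ln_gt0.
  have a : ln (ln 2) <= ln (ln r) by rewrite !ler_ln ?posrE//; lra.
  have b : ln (ln r) <= ln (ln (Num.max M 2)).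
    rewrite !ler_ln ?posrE//.
    - by rewrite le_max FMx.
    - by lra.
    - by rewrite (lt_le_trans _ (_ : 2 <= _))// le_max lexx orbT.
    - by rewrite ln_gt0// (lt_le_trans _ (_ : 2 <= _))// ?ltr1n// le_max lexx orbT.
  have := ler_norm (- ln (ln 2 : R)); rewrite normrN.
  have := ler_norm (ln (ln (Num.max M 2)) : R).
  have := normr_ge0 (ln (ln (Num.max M 2)) : R).
  have := normr_ge0 (ln (ln 2 : R)).
  by rewrite /C => *; split; lra.
have up : (limf_esup (emergence_quotient F) (0 : R)^'+ <= 0)%E.
  apply: le_of_real_ub => c; rewrite lte_fin => c0; apply: limf_esup_le.
  apply/near0P; exists (Num.max 0 (C / c)) => x; rewrite gt_max => /andP[x0 xC].
  apply: (le_trans (bound x x0).2); rewrite lee_fin.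
  by rewrite ler_pdivrMr// mulrC -ler_pdivrMr// ltW.
have dn : (0 <= limf_einf (emergence_quotient F) (0 : R)^'+)%E.
  apply: le_of_real_lb => c; rewrite lte_fin => c0; apply: limf_einf_ge.
  apply/near0P; exists (Num.max 0 (C / - c)) => x; rewrite gt_max => /andP[x0 xC].
  apply: (le_trans _ (bound x x0).1); rewrite lee_fin.
  have nc0 : 0 < - c by lra.
  by rewrite lerNr ler_pdivrMr// mulrC -ler_pdivrMr// ltW.
have mid := limf_einf_le_esup (emergence_quotient F) (_ : ProperFilter (0 : R)^'+).
split; apply/eqP; rewrite eq_le ?up ?dn ?andbT /=.
  exact: le_trans dn (mid _).
exact: le_trans (mid _) up.
Qed.

End quotient.

(** * Comparison of the growth rates *)

Section comparison.
Context {R : realType}.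
Variables (E D : R -> \bar R) (N : nat -> nat) (K : R).
Hypothesis E2 : emergence_valued E.
Hypothesis D2 : emergence_valued D.
Hypothesis ED : forall e, 0 < e -> (E e <= D e)%E.
Hypothesis D_anti : forall e e', e <= e' -> (D e' <= D e)%E.
Hypothesis K0 : 0 < K.
Hypothesis DN : forall k : nat, D (expR (- k%:R)) = (N k)%:R%:E \/
  D (expR (- k%:R)) = +oo%E /\ expR (expR (k%:R ^+ 2)) <= (N k)%:R :> R.
Hypothesis EN : forall (k : nat) (e : R),
  2 * e < expR (- k%:R) / K * scale_weight k -> (((N k)%:R / 2)%:E <= E e)%E.

(** With k the integer following x, exp (- k) is at least exp (- x - 1), and it
    remains to see that exp (eta * x) dominates a constant multiple of x ^ 2; the
    cube of eta * x / 3 is already large enough. *)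
Lemma scale_growth (eta : R) : 0 < eta -> exists x0 : R, forall x : R, x0 < x ->
  1 < x /\ exists2 k : nat, x <= k%:R &
    2 * expR (- ((1 + eta) * x)) < expR (- k%:R) / K * scale_weight k.
Proof.
move=> eta0; pose e1 := expR 1 : R.
have e10 : 0 < e1 by exact: expR_gt0.
(* 648 = 24 * 27: it ensures 24 * K * e1 * x ^ 2 < (eta * x / 3) ^ 3. *)
exists (Num.max 1 (648 * K * e1 / eta ^+ 3)) => x; rewrite gt_max => /andP[x1 xb].
split=> //.
have x0 : 0 <= x by lra.
have e3 : 0 < eta ^+ 3 by rewrite exprn_gt0.
move: xb; rewrite ltr_pdivrMr// => xb.
have kl : (Num.truncn x)%:R <= x by rewrite truncn_le.
have ku := truncnS_gt x.
set k := Num.truncn x in kl ku.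
exists k.+1; first exact: ltW.
rewrite /scale_weight.
have kr : k.+2%:R <= x + 2 :> R by rewrite -[k.+2]addn2 natrD; lra.
have kr' : k.+3%:R <= x + 3 :> R by rewrite -[k.+3]addn3 natrD; lra.
have kp : 0 < k.+2%:R * k.+3%:R :> R by rewrite mulr_gt0.
rewrite ltr_pdivlMr// ltr_pdivlMr//.
have ek : expR (- x) <= e1 * expR (- k.+1%:R).
  rewrite /e1 -expRD ler_expR -natr1; lra.
have split_exp : expR (- ((1 + eta) * x)) = expR (- x) * (expR (eta * x))^-1.
  by rewrite -expRN -expRD; congr expR; ring.
have ex0 := expR_gt0 (- k.+1%:R : R).
have eta_x := expR_gt0 (eta * x).
rewrite split_exp.
apply: (@le_lt_trans _ _ (2 * (e1 * expR (- k.+1%:R) * (expR (eta * x))^-1) * (12 * x ^+ 2) * K)).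
  rewrite ler_pM2r//; apply: ler_pM.
  - by rewrite mulr_ge0// mulr_ge0 ?invr_ge0 ?(ltW (expR_gt0 _)).
  - exact: ltW.
  - by rewrite ler_wpM2l// ler_wpM2r// invr_ge0 ltW.
  - rewrite (_ : 12 * x ^+ 2 = (3 * x) * (4 * x)); last by ring.
    by apply: ler_pM => //; [apply: (le_trans kr)|apply: (le_trans kr')]; lra.
rewrite -[ltRHS]mul1r.
rewrite (_ : 2 * _ * _ * K =
  (24 * K * e1 * x ^+ 2 / expR (eta * x)) * expR (- k.+1%:R)); last by ring.
rewrite ltr_pM2r// ltr_pdivrMr// mul1r.
have u0 : 0 < eta * x / 3 by rewrite divr_gt0// mulr_gt0//; lra.
have cube : (eta * x / 3) ^+ 3 <= expR (eta * x).
  rewrite (_ : expR (eta * x) = expR (eta * x / 3) ^+ 3).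
    apply: lerXn2r; rewrite ?nnegrE ?(ltW u0) ?(ltW (expR_gt0 _))//.
    by apply: le_trans (expR_ge1Dx _); lra.
  by rewrite -expRM_natl; congr expR; field.
apply: lt_le_trans cube.
rewrite (_ : (eta * x / 3) ^+ 3 = (x * eta ^+ 3 / 27) * x ^+ 2); last by field.
by rewrite ltr_pM2r ?exprn_gt0//; lra.
Qed.

(** The scale exp (- k) just below exp (- x) is still much larger than
    exp (- (1 + eta) * x). *)
Lemma half_lower (eta : R) : 0 < eta -> exists x0 : R, forall x : R, x0 < x ->
  1 < x /\ exists n : nat, ((n%:R / 2)%:E <= E (expR (- ((1 + eta) * x))))%E /\
    ((D (expR (- x)) <= n%:R%:E)%E \/
     (exists2 e, 0 < e & D e = +oo%E) /\ expR (expR (x ^+ 2)) <= n%:R).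
Proof.
move=> eta0; have [x0 H] := scale_growth eta0.
exists x0 => x /H[x1 [k xk kP]]; split=> //; exists (N k); split; first exact: EN.
have [Dk|[Dk Nk]] := DN k.
  by left; rewrite -Dk; apply: D_anti; rewrite ler_expR lerN2.
right; split; first by exists (expR (- k%:R)) => //; exact: expR_gt0.
by apply: le_trans Nk; rewrite !ler_expR; apply: lerXn2r; rewrite ?nnegrE//; lra.
Qed.

Local Notation qE := (emergence_quotient E).
Local Notation qD := (emergence_quotient D).

Lemma loglog_le r r' : 2 <= r -> r <= r' -> ln (ln r) <= ln (ln r') :> R.
Proof.
move=> r2 rr; have lr : 0 < ln r by rewrite ln_gt0//; lra.
have lrr : ln r <= ln r' by rewrite ler_ln ?posrE//; lra.
by rewrite ler_ln ?posrE// (lt_le_trans lr).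
Qed.

Lemma loglog_half r : 4 <= r -> ln (ln r) - ln 2 <= ln (ln (r / 2)) :> R.
Proof.
move=> r4; have l2 : 0 < ln 2 :> R by rewrite ln_gt0// ltr1n.
have l4 : ln 4 = 2 * ln 2 :> R.
  by rewrite (_ : 4 = 2 * 2 :> R) ?lnM ?posrE//; ring.
have r40 : ln 4 <= ln r :> R by rewrite ler_ln ?posrE//; lra.
have lh : ln (r / 2) = ln r - ln 2 by rewrite ln_div ?posrE//; lra.
rewrite -ln_div ?posrE//; last by lra.
by rewrite ler_ln ?posrE ?lh; [lra|rewrite divr_gt0//; lra|lra].
Qed.

Lemma quotient_ge (F : R -> \bar R) (x r : R) : 0 < x -> 2 <= r ->
  (r%:E <= F (expR (- x)))%E ->
  ((ln (ln r) / x)%:E <= emergence_quotient F (expR (- x)))%E.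
Proof.
move=> x0 r2; case Fx : (F (expR (- x))) => [y| |] // h; last first.
  by rewrite quotient_y// leey.
rewrite lee_fin in h; rewrite (@quotient_fin _ _ _ y)//; last by lra.
by rewrite lee_fin ler_pM2r ?invr_gt0//; exact: loglog_le.
Qed.

Section unbounded.
Hypothesis Dunb : forall M : R, exists2 e, 0 < e & (M%:E < D e)%E.

Let D_large (M : R) : exists x0 : R, forall x : R, x0 < x -> (M%:E <= D (expR (- x)))%E.
Proof.
have [e e0 Me] := Dunb M; exists (- ln e) => x ex; apply: (le_trans (ltW Me)).
apply: D_anti; rewrite -[leRHS]lnK ?posrE// ler_expR; lra.
Qed.

Let E_large (M : R) : exists x0 : R, forall x : R, x0 < x -> (M%:E <= E (expR (- x)))%E.
Proof.
have [x1 H1] := half_lower ltr01.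
have [x2 H2] := D_large (2 * M).
exists (2 * (Num.max (Num.max x1 x2) `|2 * M|)) => x.
rewrite mulrC -ltr_pdivlMr// !gt_max => /andP[/andP[a b] c].
have [x21 [n [nE nD]]] := H1 _ a.
have xx : (1 + 1) * (x / 2) = x by field.
rewrite xx in nE; apply: le_trans nE; rewrite lee_fin ler_pdivlMr// mulrC.
case: nD => [nD|[_ nD]].
  by rewrite -lee_fin; apply: le_trans nD; exact: H2.
apply: le_trans nD.
have := expR_ge1Dx ((x / 2) ^+ 2); have := expR_ge1Dx (expR ((x / 2) ^+ 2)).
have x22 : x / 2 <= (x / 2) ^+ 2 by rewrite expr2 ler_peMl//; lra.
have := ler_norm (2 * M); lra.
Qed.

Let qE_le_qD : \forall e \near (0 : R)^'+, (qE e <= qD e)%E.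
Proof.
have [x1 H1] := E_large 2; apply/near0P; exists (Num.max x1 0) => x.
rewrite gt_max => /andP[xx1 x0].
have E2x := H1 _ xx1; have EDx := ED (expR_gt0 (- x)).
case Ex : (E (expR (- x))) => [r| |].
- rewrite Ex lee_fin in E2x; rewrite (@quotient_fin _ _ _ r)//; last by lra.
  by apply: quotient_ge => //; rewrite -Ex.
- by move: EDx; rewrite Ex leye_eq => /eqP Dx; rewrite !quotient_y.
- by rewrite Ex in E2x.
Qed.

(** The witness y is ln (ln (r / 2)) / ((1 + eta) * x), where r is the value of D
    at exp (- x); the loss of ln 2 is absorbed by eta * x. *)
Let loglog_comparison (eta : R) : (forall e, 0 < e -> D e != +oo%E) -> 0 < eta ->
  exists x0 : R, forall x : R, x0 < x -> 0 < x /\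
    exists y : R, (y%:E <= qE (expR (- ((1 + eta) * x))))%E /\
      (qD (expR (- x)) <= ((1 + eta) * y + eta)%:E)%E.
Proof.
move=> Dfin eta0; have [x1 H1] := half_lower eta0; have [x2 H2] := D_large 4.
exists (Num.max (Num.max x1 x2) (ln 2 / eta)) => x.
rewrite !gt_max => /andP[/andP[a b] c].
have [x11 [n [nE nD]]] := H1 _ a.
have x0 : 0 < x by lra.
split=> //.
have D4 := H2 _ b.
have {}nD : (D (expR (- x)) <= n%:R%:E)%E.
  by case: nD => // -[[e e0 De] _]; have := Dfin e e0; rewrite De eqxx.
case Dx : (D (expR (- x))) => [r| |]; last 2 first.
- by have := Dfin _ (expR_gt0 (- x)); rewrite Dx eqxx.
- by rewrite Dx in D4.
rewrite Dx lee_fin in D4; rewrite Dx lee_fin in nD.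
have e1 : 0 < 1 + eta by lra.
have ex0 : 0 < (1 + eta) * x by rewrite mulr_gt0.
exists (ln (ln (r / 2)) / ((1 + eta) * x)); split.
  apply: quotient_ge => //; first by lra.
  by apply: le_trans nE; rewrite lee_fin ler_pM2r.
rewrite (@quotient_fin _ _ _ r)//; last by lra.
rewrite lee_fin ler_pdivrMr// mulrDl.
have -> : (1 + eta) * (ln (ln (r / 2)) / ((1 + eta) * x)) * x = ln (ln (r / 2)).
  by field; rewrite !gt_eqF.
have := loglog_half D4.
rewrite ltr_pdivrMr// in c; lra.
Qed.

Let slack (c eps : R) : 0 < eps -> exists2 eta : R, 0 < eta &
  (1 + eta) * c + eta <= c + eps /\ c - eps <= (c - eta) / (1 + eta).
Proof.
move=> e0; exists (eps / (1 + `|c|)); first by rewrite divr_gt0// ltr_pwDl.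
have c1 : 0 < 1 + `|c| by rewrite ltr_pwDl.
have e1 : 0 < eps / (1 + `|c|) by rewrite divr_gt0.
have ee : eps / (1 + `|c|) * (1 + `|c|) = eps by rewrite divfK// gt_eqF.
have cn := ler_norm c; have cn' := ler_norm (- c); rewrite normrN in cn'.
have cn0 := normr_ge0 c.
move: (eps / _) e1 ee => eta eta0 <-.
move: (`|c|) cn cn' cn0 => a ca ca' a0; split; first by nra.
by rewrite ler_pdivlMr; [nra|lra].
Qed.

Let quotient_limits_finite : (forall e, 0 < e -> D e != +oo%E) ->
  limf_esup qE (0 : R)^'+ = limf_esup qD (0 : R)^'+ /\
  limf_einf qE (0 : R)^'+ = limf_einf qD (0 : R)^'+.
Proof.
move=> Dfin; split; apply/eqP; rewrite eq_le; apply/andP; split.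
- by apply: limf_esup_mono; exact: qE_le_qD.
- apply: le_of_real_ub => c /limf_esup_lt/near0P[x1 H1].
  apply/lee_addgt0Pr => eps eps0; apply: limf_esup_le.
  have [eta eta0 [s1 _]] := slack c eps0.
  have [x2 H2] := loglog_comparison Dfin eta0.
  apply/near0P; exists (Num.max x1 x2) => x; rewrite gt_max => /andP[a b].
  have [x0 [y [yE yD]]] := H2 _ b.
  apply: (le_trans yD); rewrite -EFinD lee_fin; apply: le_trans s1.
  have xx : x1 < (1 + eta) * x by nra.
  have := le_lt_trans yE (H1 _ xx); rewrite lte_fin => yc.
  by rewrite lerD2r ler_wpM2l//; lra.
- by apply: limf_einf_mono; exact: qE_le_qD.
- apply: le_of_real_lb => c /limf_einf_gt/near0P[x1 H1].
  apply/lee_addgt0Pr => eps eps0; rewrite -leeBlDr//; apply: limf_einf_ge.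
  have [eta eta0 [_ s2]] := slack c eps0.
  have [x2 H2] := loglog_comparison Dfin eta0.
  apply/near0P; exists ((1 + eta) * Num.max x1 x2) => x; rewrite mulrC.
  have e1 : 0 < 1 + eta by lra.
  rewrite -ltr_pdivlMr// gt_max => /andP[a b].
  have [x0 [y [yE yD]]] := H2 _ b.
  have xx : (1 + eta) * (x / (1 + eta)) = x by field; rewrite gt_eqF.
  rewrite xx in yE; apply: le_trans yE; rewrite -EFinB lee_fin.
  apply: (le_trans s2); rewrite ler_pdivrMr//.
  have := lt_le_trans (H1 _ a) yD; rewrite lte_fin; lra.
Qed.

(** For e small, the number n of [half_lower] is at least exp (exp (x ^ 2)), so
    the quotient for E grows at least like x. *)
Let quotient_limits_infinite (e0 : R) : 0 < e0 -> D e0 = +oo%E ->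
  limf_esup qE (0 : R)^'+ = limf_esup qD (0 : R)^'+ /\
  limf_einf qE (0 : R)^'+ = limf_einf qD (0 : R)^'+.
Proof.
move=> e00 De0.
have einfE : limf_einf qE (0 : R)^'+ = +oo%E.
  apply/eqP; rewrite -leye_eq; apply: le_of_real_lb => M _; apply: limf_einf_ge.
  have [x1 H1] := half_lower ltr01.
  apply/near0P; exists (2 * Num.max (Num.max x1 (- ln e0)) (2 * `|M| + 1)) => x.
  rewrite mulrC -ltr_pdivlMr// !gt_max => /andP[/andP[a b] c].
  have [x21 [n [nE nD]]] := H1 _ a.
  have xx : (1 + 1) * (x / 2) = x by field.
  rewrite xx in nE.
  have {nD}nD : expR (expR ((x / 2) ^+ 2)) <= n%:R.
    case: nD => [|[]//].
    have /eqP -> : D (expR (- (x / 2))) == +oo%E.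
      rewrite -leye_eq -De0; apply: D_anti.
      by rewrite -[leRHS]lnK ?posrE// ler_expR; lra.
    by rewrite leye_eq.
  have sq : 1 < (x / 2) ^+ 2 by rewrite expr2; nra.
  have n4 : 4 <= n%:R :> R.
    apply: le_trans nD.
    have := expR_ge1Dx (x / 2); have := expR_ge1Dx ((x / 2) ^+ 2).
    have := expR_ge1Dx (expR ((x / 2) ^+ 2)) => h1 h2 h3.
    have h4 := expR_ge1Dx (1 : R).
    have h5 : expR 1 <= expR ((x / 2) ^+ 2) by rewrite ler_expR ltW.
    have : expR (1 + 1) <= expR (expR ((x / 2) ^+ 2)) by rewrite ler_expR; lra.
    by rewrite expRD; nra.
  have lln : (x / 2) ^+ 2 <= ln (ln n%:R).
    have n0 : 0 < n%:R :> R by lra.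
    have h1 : expR ((x / 2) ^+ 2) <= ln n%:R by rewrite -ler_expR lnK ?posrE.
    have h0 := expR_gt0 ((x / 2) ^+ 2).
    by rewrite -ler_expR lnK// posrE; apply: lt_le_trans h1.
  have x0 : 0 < x by lra.
  apply: (le_trans _ (quotient_ge x0 _ nE)); last by lra.
  rewrite lee_fin ler_pdivlMr//.
  apply: le_trans (loglog_half n4).
  have l2 : ln 2 <= 1 :> R by have := @le_ln1Dx R 1; rewrite (_ : 1 + 1 = 2 :> R)//; apply; lra.
  have := ler_norm M; have := normr_ge0 M.
  move: (`|M|) c => m c m0 Mm.
  have y0 : x = 2 * (x / 2) by field.
  rewrite y0; move: (x / 2) x21 c lln => y x21 c lln.
  by rewrite expr2 in lln; nra.
have esupE : limf_esup qE (0 : R)^'+ = +oo%E.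
  by apply/eqP; rewrite -leye_eq -einfE; exact: limf_einf_le_esup.
have einfD : limf_einf qD (0 : R)^'+ = +oo%E.
  by apply/eqP; rewrite -leye_eq -einfE; apply: limf_einf_mono; exact: qE_le_qD.
split; first last.
  by rewrite einfE einfD.
rewrite esupE; apply/esym/eqP; rewrite -leye_eq -einfD; exact: limf_einf_le_esup.
Qed.

Lemma quotient_limits_unbounded :
  limf_esup qE (0 : R)^'+ = limf_esup qD (0 : R)^'+ /\
  limf_einf qE (0 : R)^'+ = limf_einf qD (0 : R)^'+.
Proof.
have [[e e0 De]|nD] := pselect (exists2 e, 0 < e & D e = +oo%E).
  exact: quotient_limits_infinite e0 De.
by apply: quotient_limits_finite => e e0; apply/eqP => De; apply: nD; exists e.
Qed.

End unbounded.

Lemma quotient_limits :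
  limf_esup qE (0 : R)^'+ = limf_esup qD (0 : R)^'+ /\
  limf_einf qE (0 : R)^'+ = limf_einf qD (0 : R)^'+.
Proof.
have [[M DM]|nM] := pselect (exists M : R, forall e, 0 < e -> (D e <= M%:E)%E).
  have [-> ->] := quotient_limits_bounded D2 DM.
  by apply: (@quotient_limits_bounded _ _ M) => // e e0; apply: le_trans (ED e0) (DM _ e0).
apply: quotient_limits_unbounded => M; apply: contrapT => h; apply: nM.
exists M => e e0; rewrite leNgt; apply/negP => Me; apply: h; by exists e.
Qed.

End comparison.

(** * The variational principle *)

Lemma least_emergence_valued (R : realType) (A : R -> set nat) :
  (forall e, (1 <= least (A e) :> \bar R)%E) ->
  emergence_valued (fun e => least (A e) : \bar R).
Proof.
move=> A1 e; have := A1 e; have [->|[n ->]] := leastP (R := R) (A e).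
  by right; rewrite leey.
rewrite lee_fin ler1n => n0; have [n1|n1] := leqP n 1; [left|right].
  by have -> : n = 1%N by apply/eqP; rewrite eqn_leq n1.
by rewrite lee_fin ler_nat.
Qed.

Theorem theorem5 (R : realType) (X : pmetricType R) (f : X -> X)
    (dist : probability (borel X) R -> probability (borel X) R -> \bar R) :
  compact [set: X] -> continuous f ->
  ([set wasserstein p | p in `[1, +oo[] `|` [set levy_prokhorov]) dist ->
  exists mu : probability (borel X) R,
    [/\ invariant_measure f mu,
        limf_esup (emergence_quotient (metric_emergence dist f mu)) (0^'+) =
        limf_esup (emergence_quotient (topological_emergence dist f)) (0^'+) &
        limf_einf (emergence_quotient (metric_emergence dist f mu)) (0^'+) =
        limf_einf (emergence_quotient (topological_emergence dist f)) (0^'+)].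
Proof.
move=> cX cf distE.
have distM : emergence_metric dist.
  case: distE => [[p + <-]|->]; last exact: levy_prokhorov_emergence_metric.
  by rewrite /= in_itv /= andbT; exact: wasserstein_emergence_metric.
have [K K0 tri] := em_quasi_triangle distM.
pose D := topological_emergence dist f.
have D1 e : (1 <= D e)%E by exact: topological_emergence_ge1.
have HN (k : nat) : exists n : nat, [/\ (0 < n)%N, (n%:R%:E <= D (expR (- k%:R)))%E &
    D (expR (- k%:R)) = n%:R%:E \/
    D (expR (- k%:R)) = +oo%E /\ expR (expR (k%:R ^+ 2)) <= n%:R :> R].
  have Dk : D (expR (- k%:R)) = +oo%E \/ exists n : nat, D (expR (- k%:R)) = n%:R%:E.
    exact: leastP.
  have := D1 (expR (- k%:R)); case: Dk => [->|[n ->]]; last first.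
    by rewrite lee_fin ler1n => n0; exists n; split => //; left.
  (* Any number of separated ergodic measures is available at this scale. *)
  move=> _; exists (Num.truncn (expR (expR (k%:R ^+ 2)) : R)).+1.
  by split; rewrite ?leey//; right; split => //; exact/ltW/truncnS_gt.
have [N NP] := choice HN.
have Hs k : exists s : nat -> probability (borel X) R,
    (forall i, (i < N k)%N -> ergodic_measure f (s i)) /\
    (forall i j, (i < j < N k)%N -> ((expR (- k%:R))%:E < dist (s i) (s j))%E).
  by apply: separated_ergodic; have [_ + _] := NP k; exact.
have [s sP] := choice Hs.
have N0 k : (0 < N k)%N by have [] := NP k.
have sE k i : (i < N k)%N -> ergodic_measure f (s k i) by exact: (sP k).1.
have [mu [muI mu_null mu_lb]] := scale_mixture_exists N0 sE.
exists mu; have [] := @quotient_limits R (metric_emergence dist f mu) D N K.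
- by apply: least_emergence_valued => e; exact: metric_emergence_ge1.
- by apply: least_emergence_valued => e; exact: D1.
- by move=> e e0; apply: (metric_emergence_le_topological cX distM cf sE mu_null); exact: ltW.
- by move=> e e' ee; exact: topological_emergence_le.
- exact: K0.
- by move=> k; have [_ _] := NP k.
- move=> k e ek.
  have r0 : 0 < expR (- k%:R) / K by rewrite divr_gt0// expR_gt0.
  have sep i j : (i < j < N k)%N ->
      ((K * (expR (- k%:R) / K))%:E < dist (s k i) (s k j))%E.
    by rewrite mulrC divfK ?gt_eqF//; exact: (sP k).2.
  exact: (metric_emergence_ge_half cX distM cf N0 sE mu_lb r0 tri sep ek).
by move=> Esup Einf; split.
Qed.
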